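(* Let $p$ and $p+2$ be twin prime powers (i.e. both are prime powers) satisfying $p>2$. Then there exists an elementary $(\mathbb{F}_{p}^+ \times \mathbb{F}_{p+2}^+\times\mathbb{F}_{q}^+,\ \mathbb{F}_{p}^+ \times \mathbb{F}_{p+2}^+\times \{0\},\ p(p+2)+1,\ 1)$-FDF for any prime power $q\equiv 1 \pmod{p(p+2)+1}$ with $q>Q((p(p+2)+1)/2,\,p(p+2))$.
   Context: Unions of (multi)sets are multiset unions, and $\underline{h}A$ denotes the multiset union of $h$ copies of $A$. $\mathbb{F}_q^+$ is the additive group of the finite field $\mathbb{F}_q$. For positive integers $d,m$, $$Q(d,m)=\tfrac14\left(U+\sqrt{U^2+4d^{m-1}m}\right)^2,\qquad U=\sum_{h=1}^m \binom{m}{h}(d-1)^h(h-1).$$ Frame difference family: let $H$ be a finite abelian group with a subgroup $N$ of order $n$. An $(H,N,k,\lambda)$-DF (relative difference family) is a family $\mathfrak{B}=[B_1,\dots,B_r]$ of $k$-subsets of $H$ (base blocks) such that the multiset $\bigcup_{i=1}^r[x-y:x,y\in B_i,\ x\neq y]$ equals $\underline{\lambda}(H\setminus N)$. It is an $(H,N,k,\lambda)$-FDF if it can be partitioned into $\lambda n/(k-1)$ subfamilies, each consisting of $(|H|-n)/(nk)$ base blocks, such that the union of the base blocks in each subfamily is a system of representatives for the nontrivial cosets of $N$ in $H$. The FDF is elementary if $\lambda n=k-1$. *)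

(* Defs.v *)
From HB Require Import structures.
From mathcomp Require Import all_boot all_order all_algebra.

Set Implicit Arguments.
Unset Strict Implicit.
Unset Printing Implicit Defensive.

Import Order.TTheory GRing.Theory Num.Theory.
Local Open Scope ring_scope.

(* The library declares no finZmodType structure on products; this derives it. *)
HB.saturate prod.

Definition prime_power (n : nat) : Prop :=
  exists r e : nat, [/\ prime r, (0 < e)%N & n = (r ^ e)%N].

Section Threshold.

Variable R : rcfType.

Definition Ubound (d m : nat) : R :=
  \sum_(1 <= h < m.+1) 'C(m, h)%:R * (d%:R - 1) ^+ h * (h%:R - 1).

Definition Qbound (d m : nat) : R :=
  4^-1 * (Ubound d m +
          Num.sqrt (Ubound d m ^+ 2 + 4 * d%:R ^+ m.-1 * m%:R)) ^+ 2.

End Threshold.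

(* Multisets are sequences up to perm_eq; a family of blocks is a sequence of
   sets, so that repeated blocks are allowed. *)
Section FrameDifferenceFamilies.

Variable H : finZmodType.

Definition differences (B : {set H}) : seq H :=
  [seq xy.1 - xy.2 | xy <- enum (setX B B) & xy.1 != xy.2].

Definition is_DF (N : {set H}) (k lambda : nat) (BB : seq {set H}) : Prop :=
  [/\ zmod_closed N,
      {in BB, forall B : {set H}, #|B| = k}
    & perm_eq (flatten [seq differences B | B <- BB])
              (flatten (nseq lambda (enum (~: N))))].

Definition add_coset (N : {set H}) (x : H) : {set H} := [set x + y | y in N].

Definition nontrivial_cosets (N : {set H}) : {set {set H}} :=
  [set add_coset N x | x : H] :\ N.

(* Each nontrivial coset of N contains exactly one term of s, counted with
   multiplicity, and no term of s lies in N. *)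
Definition represents_nontrivial_cosets (N : {set H}) (s : seq H) : Prop :=
  perm_eq [seq add_coset N x | x <- s] (enum (nontrivial_cosets N)).

(* The numbers lambda n / (k - 1) of subfamilies and (|H| - n) / (n k) of blocks
   in each are cross-multiplied, so that the quotients are exact. *)
Definition is_FDF (N : {set H}) (k lambda : nat) (BB : seq {set H}) : Prop :=
  is_DF N k lambda BB /\
  exists PP : seq (seq {set H}),
    [/\ perm_eq (flatten PP) BB,
        (size PP * (k - 1) = lambda * #|N|)%N
      & {in PP, forall S : seq {set H},
          (size S * (#|N| * k) = #|H| - #|N|)%N /\
          represents_nontrivial_cosets N
            (flatten [seq enum B | B : {set H} <- S])}].

Definition is_elementary_FDF (N : {set H}) (k lambda : nat)
    (BB : seq {set H}) : Prop :=
  is_FDF N k lambda BB /\ (lambda * #|N| = k - 1)%N.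

End FrameDifferenceFamilies.

(* Main.v *)
Require Import Defs.
From HB Require Import structures.
From mathcomp Require Import all_boot all_order all_algebra.
From mathcomp Require Import all_fingroup all_solvable all_field.
From mathcomp Require Import ring lra zify.

Set Implicit Arguments.
Unset Strict Implicit.
Unset Printing Implicit Defensive.

Import Order.TTheory GRing.Theory Num.Theory.
Local Open Scope ring_scope.

(** Write v = p(p+2), k = v + 1 = 2d and e = (q-1)/d, and let C be the subgroup
    of d-th powers in F_q^*, of even order e.  The complement D of the twin
    prime power difference set of G = F_p x F_(p+2) has d elements, and each
    nonzero g is a difference of two of them in d/2 ways.  Suppose that
    y : G -> F_q sends the elements of D to distinct cosets of C and that, for
    each g <> 0, the d elements y(u) - y(u') and y(u) + y(u') with u - u' = g
    also lie in distinct cosets.  As -1 is in C, choose one element from each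
    pair {c, -c} of C to form a set S.  The blocks
    { (u, s y(u)), (u, - s y(u)) : u in D }, for s in S, solve the problem: the
    differences over g <> 0 are the +-s (y(u) +- y(u')), those over 0 are the
    +-2 s y(u), and each of these lists covers F_q^*.  It covers it exactly
    once because the cardinalities agree, so that only surjectivity has to be
    checked ([perm_enum_of_cover], [blocks_FDF]).

    The values y(u) are found one after the other ([signed_lift]).  The next one
    is an x such that at most 2d - 1 = v given translates c - x, with distinct
    c, lie in given cosets of C.  Its existence ([class_selection]) is the usual
    count with the characters of order dividing d: the trivial characters
    contribute q, the others are bounded by Weil's theorem, the points x = c
    contribute at most v d^(v-1) in excess, and q > Q(d, v) says exactly that the
    first of these terms dominates ([threshold_nat]).

    Weil's bound |sum_x prod_i chi_i(c_i - x)| <= (h - 1) sqrt q for h distinct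
    points ([weil_bound]) is obtained from the L-function sum_g chi(g) T^deg(g),
    where g runs over the monic polynomials over F_q and
    chi(g) = prod_i chi_i(g(c_i)).  It is a polynomial of degree less than h,
    since the values (g(c_i))_i are equidistributed in degree at least h
    ([L_coef_eq0]).  Counting the Frobenius orbits of roots of each g shows that
    the power sums of its inverse roots are, up to sign, the character sums over
    the extensions of F_q ([newton_L_coef]).  Stepanov's method bounds the sum
    over the extension of degree 2r by a constant times q^r
    ([stepanov_bound], [extension_sum_bound]); hence each inverse root has
    absolute value at most sqrt q ([power_sum_dominance]), and the sum over F_q
    itself is minus the sum of at most h - 1 of them. *)

(** * Power sums *)

(** The induction adds one factor 1 - w X to the product L; the new terms
    w ^ r L_(n-r) then telescope. *)
Lemma newton_identity (A : comNzRingType) (ws : seq A) (n : nat) :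
  let L := \prod_(w <- ws) (1 - w *: 'X) in
  n%:R * L`_n
    = - \sum_(1 <= r < n.+1) (\sum_(w <- ws) w ^+ r) * L`_(n - r).
Proof.
elim: ws n => [|w ws IH] n /=.
  rewrite big_nil coef1 big1 ?oppr0 => [|r _]; last by rewrite big_nil mul0r.
  by case: n => [|n]; rewrite ?mul0r ?mulr0.
rewrite big_cons; set L := \prod_(w <- ws) _ in IH *.
have coefL k : ((1 - w *: 'X) * L)`_k = L`_k - w * (if k is k'.+1 then L`_k' else 0).
  rewrite mulrBl mul1r coefB -scalerAl coefZ coefXM.
  by case: k.
have {}IH k : k%:R * L`_k = - \sum_(1 <= r < k.+1) (\sum_(w <- ws) w ^+ r) * L`_(k - r)
  by apply: IH.
case: n => [|n]; first by rewrite mul0r big_geq ?oppr0.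
under eq_bigr do rewrite big_cons mulrDl.
rewrite big_split /= opprD.
have -> : \sum_(1 <= r < n.+2) w ^+ r * ((1 - w *: 'X) * L)`_(n.+1 - r) = w * L`_n.
  rewrite big_add1 /=.
  pose u i := - (w ^+ i.+1 * (if (n.+1 - i)%N is k.+1 then L`_k else 0)).
  have -> : \sum_(0 <= i < n.+1) w ^+ i.+1 * ((1 - w *: 'X) * L)`_(n.+1 - i.+1)
     = \sum_(0 <= i < n.+1) (u i.+1 - u i).
    rewrite !big_nat; apply: eq_bigr => i /= lin.
    rewrite coefL /u subSS subSn // opprK mulrBr addrC; congr (_ + _).
    by case: (n - i)%N => [|k]; rewrite ?mulr0 // mulrA -exprSr.
  by rewrite telescope_sumr // /u subnn subn0 expr1 mulr0 oppr0 sub0r opprK.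
rewrite coefL mulrBr IH.
rewrite [\sum_(1 <= r < n.+2) _]big_nat_recr //=.
rewrite [\sum_(1 <= i < n.+2) _ * ((1 - _) * L)`_ _]big_nat_recr //= subnn coefL mulr0
  subr0.
have -> : \sum_(1 <= i < n.+1) (\sum_(w0 <- ws) w0 ^+ i) * ((1 - w *: 'X) * L)`_(n.+1 -
  i)
   = \sum_(1 <= i < n.+1) (\sum_(w0 <- ws) w0 ^+ i) * L`_(n.+1 - i)
     - w * \sum_(1 <= i < n.+1) (\sum_(w0 <- ws) w0 ^+ i) * L`_(n - i).
  rewrite mulr_sumr -sumrB !big_nat; apply: eq_bigr => i /andP[_ lin].
  rewrite subSn // coefL; ring.
have := IH n; set S := \sum_(1 <= i < n.+1) _ * L`_(n - i) => Hn.
have -> : n.+1%:R * (w * L`_n) = w * L`_n + w * (n%:R * L`_n) by rewrite -natr1; ring.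
rewrite Hn; ring.
Qed.

(** A bound on the power sums bounds each term: the polynomial P below vanishes
    at all the other terms, so that the combination of consecutive power sums
    with the coefficients of P isolates w ^ N, up to a nonzero factor that does
    not depend on N.  Letting N grow gives |w| <= B. *)
Lemma power_sum_dominance (ws : seq algC) (C B : algC) (N0 : nat) :
    0 < B -> (forall N, (N0 <= N)%N -> `|\sum_(w <- ws) w ^+ N| <= C * B ^+ N) ->
  {in ws, forall w, `|w| <= B}.
Proof.
move=> B0 H w wws.
pose P := \prod_(z <- undup ws | z != w) ('X - z%:P).
have Pw : P.[w] != 0.
  rewrite /P horner_prod prodf_seq_neq0; apply/allP => z _; apply/implyP => zw.
  by rewrite hornerXsubC subr_eq0 eq_sym.
have P0 z : z \in ws -> z != w -> P.[z] = 0.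
  move=> zws zw; apply/eqP; rewrite /P horner_prod prodf_seq_eq0; apply/hasP.
  by exists z; rewrite ?mem_undup //= zw hornerXsubC subrr eqxx.
have key N : \sum_(k < size P) P`_k * (\sum_(z <- ws) z ^+ (N + k)) =
  (w ^+ N * P.[w]) *+ count_mem w ws.
  transitivity (\sum_(z <- ws) z ^+ N * P.[z]).
    under eq_bigr do rewrite mulr_sumr.
    rewrite exchange_big; apply: eq_bigr => z _.
    rewrite horner_coef mulr_sumr; apply: eq_bigr => k _.
    by rewrite exprD; ring.
  rewrite (bigID (xpred1 w)) /= [X in _ + X]big1_seq ?addr0; last first.
    by move=> z /andP[zw zws]; rewrite P0 ?mulr0.
  rewrite (eq_bigr (fun=> w ^+ N * P.[w])); last by move=> z /eqP->.
  by rewrite big_const_seq iter_addr_0.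
pose D := C * \sum_(k < size P) `|P`_k| * B ^+ k.
have bd N : (N0 <= N)%N -> `|w| ^+ N * `|P.[w]| <= D * B ^+ N.
  move=> leN; have c0 : (0 < count_mem w ws)%N by rewrite -has_count has_pred1.
  apply: (@le_trans _ _ `|(w ^+ N * P.[w]) *+ count_mem w ws|).
    rewrite normrMn normrM normrX -mulr_natr ler_peMr ?ler1n //.
    by rewrite mulr_ge0 ?exprn_ge0.
  rewrite -key (le_trans (ler_norm_sum _ _ _)) // /D [C * _]mulrC -mulrA mulr_suml.
  apply: ler_sum => k _; rewrite normrM.
  rewrite -mulrA ler_wpM2l //.
  rewrite (le_trans (H _ _)) ?(leq_trans leN) ?leq_addr // exprD.
  by rewrite le_eqVlt; apply/orP; left; apply/eqP; ring.
case: (real_leP (normr_real w) (gtr0_real B0)) => // ltB.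
pose t := `|w| / B - 1.
have t0 : 0 < t by rewrite subr_gt0 ltr_pdivlMr ?mul1r.
(* Bernoulli's inequality: the powers of |w| / B would be unbounded. *)
have bern N : 1 + t *+ N <= (1 + t) ^+ N.
  elim: N => [|N IH]; first by rewrite mulr0n addr0.
  have e1 : 1 <= (1 + t) ^+ N by rewrite (le_trans _ IH) // lerDl mulrn_wge0 // ltW.
  have -> : 1 + t *+ N.+1 = (1 + t *+ N) + t by rewrite mulrS; ring.
  by rewrite exprS mulrDl mul1r lerD // ler_peMr // ltW.
pose Y := D / `|P.[w]| / t.
have Pw0 : 0 < `|P.[w]| by rewrite normr_gt0.
have bd2 N : (N0 <= N)%N -> t *+ N <= D / `|P.[w]|.
  move=> leN; rewrite (@le_trans _ _ ((1 + t) ^+ N)) //.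
    by rewrite (le_trans _ (bern N)) // lerDr ler01.
  rewrite addrC subrK ler_pdivlMr // expr_div_n mulrAC ler_pdivrMr ?exprn_gt0 //.
  exact: bd.
have YR : 0 <= Y by rewrite /Y ler_pdivlMr // mul0r (le_trans _ (bd2 _ (leqnn N0))) //
  mulrn_wge0 // ltW.
have := bd2 _ (leq_maxl N0 (Num.bound Y)).
rewrite -mulr_natr mulrC -ler_pdivlMr // -/Y => contra.
have := archi_boundP YR.
have : (Num.bound Y)%:R <= (maxn N0 (Num.bound Y))%:R :> algC by rewrite ler_nat
  leq_maxr.
move=> /le_trans/(_ contra) h1 /lt_le_trans/(_ h1).
by rewrite ltxx.
Qed.

(** * Linear independence of the powers of a Kummer generator *)

(** If P divides X^d - u, its companion matrix C satisfies C^d = u, and taking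
    determinants makes a power of u a d-th power. *)
Lemma binomial_factor_norm (M : fieldType) (d : nat) (u : M) (P : {poly M}) :
    (1 < size P <= d)%N -> P %| 'X^d - u%:P ->
  exists s w, [/\ (0 < s < d)%N & w ^+ d = u ^+ s].
Proof.
move=> /andP[P1 Pd] dvd.
have lcP : lead_coef P != 0 by rewrite lead_coef_eq0 -size_poly_gt0 ltnW.
pose P' := (lead_coef P)^-1 *: P.
have szP' : size P' = size P by rewrite size_scale ?invr_eq0.
have monP' : P' \is monic by rewrite monicE lead_coefZ mulVf.
have {dvd} : P' %| 'X^d - u%:P by rewrite dvdpZl ?invr_eq0.
have := companionmxK monP'; move: (companionmx _); rewrite /= szP'.
case: (size P) P1 Pd => [|[|n]] //= _ ltnd C charC.
case/dvdpP => v Ev.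
have : horner_mx C ('X^d - u%:P) = 0.
  by rewrite Ev rmorphM /= -charC Cayley_Hamilton mulr0.
rewrite rmorphB rmorphXn /= horner_mx_X horner_mx_C => /eqP; rewrite subr_eq0 =>
  /eqP CE.
exists n.+1, (\det C); split=> //.
have detX k : \det (C ^+ k) = \det C ^+ k.
  by elim: k => [|k IH]; rewrite ?det1 // !exprS -IH -det_mulmx.
by rewrite -detX CE det_scalar.
Qed.

Lemma fraction_ratio (A : idomainType) (x : {fraction A}) :
  exists n m : A, m != 0 /\ x * FracField.tofrac m = FracField.tofrac n.
Proof.
elim/quotW: x => x; exists (frac x).1, (frac x).2; split; first exact: denom_ratioP.
unlock FracField.tofrac; rewrite -[LHS]FracField.pi_mul; apply/eqmodP => /=.
rewrite /FracField.equivf /FracField.mulf /=.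
by rewrite !numden_Ratio ?mulr1 ?oner_neq0 ?denom_ratioP // mulrC.
Qed.

(** Elements of {poly {poly K}} stand for polynomials in two variables x and y,
    with y the outer one; this bounds the degree in x. *)
Definition coefs_below (K : nzRingType) b (p : {poly {poly K}}) :=
  forall j : nat, (size (nth 0%R p j) <= b.+1)%N.

Section CoefsBelow.
Variable K : idomainType.
Implicit Types p q : {poly {poly K}}.

Lemma coefs_below0 b : coefs_below b (0 : {poly {poly K}}).
Proof. by move=> j; rewrite coef0 size_poly0. Qed.

Lemma coefs_belowW b b' p : (b <= b')%N -> coefs_below b p -> coefs_below b' p.
Proof. by move=> le H j; rewrite (leq_trans (H j)). Qed.

Lemma coefs_belowD b p q : coefs_below b p -> coefs_below b q -> coefs_below b (p + q).
Proof.
by move=> Hp Hq j; rewrite coefD (leq_trans (size_polyD _ _)) // geq_max Hp Hq.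
Qed.

Lemma coefs_belowN b p : coefs_below b p -> coefs_below b (- p).
Proof. by move=> Hp j; rewrite coefN size_polyN. Qed.

Lemma coefs_below_sum b I (r : seq I) (P : pred I) (G : I -> {poly {poly K}}) :
  (forall i, P i -> coefs_below b (G i)) -> coefs_below b (\sum_(i <- r | P i) G i).
Proof. by move=> H; elim/big_rec: _ => [|i p Pi];
  [apply: coefs_below0 | apply: coefs_belowD (H i Pi)]. Qed.

Lemma coefs_belowM b b' p q :
  coefs_below b p -> coefs_below b' q -> coefs_below (b + b') (p * q).
Proof.
move=> Hp Hq j; rewrite coefM (leq_trans (size_sum _ _ _)) //.
apply/bigmax_leqP => i _; rewrite (leq_trans (size_polyMleq _ _)) //.
by have := Hp i; have := Hq (j - i)%N; lia.
Qed.

Lemma coefs_belowC b (a : {poly K}) : (size a <= b.+1)%N -> coefs_below b a%:P.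
Proof. by move=> H j; rewrite coefC; case: eqP => // _; rewrite size_poly0. Qed.

Lemma coefs_below_map b (a : {poly K}) : coefs_below b (map_poly polyC a).
Proof. by move=> j; rewrite coef_map /= (leq_trans (size_polyC_leq1 _)). Qed.

Lemma coefs_below_det b n (A : 'M[{poly {poly K}}]_n) :
  (forall i j, coefs_below b (A i j)) -> coefs_below (n * b) (\det A).
Proof.
move=> H; apply: coefs_below_sum => s _.
have : coefs_below (n * b) (\prod_i A i (s i)).
  rewrite -[n in (n * b)%N]card_ord -sum_nat_const.
  elim/big_rec2: _ => [|i p m _ Hp]; last exact: coefs_belowM.
  by apply: coefs_belowC; rewrite size_poly1.
by case: (odd_perm s); rewrite ?expr1 ?expr0 ?mulN1r ?mul1r //; apply: coefs_belowN.
Qed.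

(** When the degree in x is below Q, the monomials x^t y^j have distinct images
    under y = x^Q. *)
Lemma coefs_below_subst_eq0 b Q p :
  (b < Q)%N -> coefs_below b p -> p.['X^Q] = 0 -> p = 0.
Proof.
move=> ltbQ Hp p0; apply/polyP => j; rewrite coef0; apply/polyP => t; rewrite coef0.
have [|letb] := ltnP b t; first by move=> ltbt; rewrite nth_default // (leq_trans (Hp
  j)).
have [/(nth_default 0)->|ltj] := leqP (size p) j; first by rewrite coef0.
have := congr1 (fun r : {poly K} => r`_(j * Q + t)) p0.
rewrite coef0 horner_coef coef_sum (bigD1 (Ordinal ltj)) //= big1 ?addr0.
  by rewrite -exprM mulnC coefMXn ltnNge leq_addr /= addKn.
move=> i neq; rewrite -exprM mulnC coefMXn; case: ltnP => // le.
have {neq} neq : nat_of_ord i != j by [].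
rewrite nth_default // (leq_trans (Hp i)) //.
have : (i < j)%N.
  by rewrite ltn_neqAle neq leqNgt; apply/negP => lt; nia.
by nia.
Qed.

End CoefsBelow.

Section MultiplicityComplements.

Lemma mupX (F : fieldType) (c : F) (p : {poly F}) n : p != 0 ->
  mup c (p ^+ n) = (n * mup c p)%N.
Proof.
move=> p0; elim: n => [|n IH]; first by rewrite expr0 mupNroot // root1.
by rewrite exprS mupM ?expf_neq0 // IH mulSn.
Qed.

Lemma mup_map (F F' : fieldType) (phi : {rmorphism F -> F'}) (c : F) p : p != 0 ->
  mup (phi c) (map_poly phi p) = mup c p.
Proof.
move=> p0; have p0' : map_poly phi p != 0 by rewrite map_poly_eq0.
have ge n : (n <= mup (phi c) (map_poly phi p))%N = (n <= mup c p)%N.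
  rewrite !mup_geq //.
  have -> : ('X - (phi c)%:P) ^+ n = map_poly phi (('X - c%:P) ^+ n).
    by rewrite rmorphXn /= map_polyXsubC.
  exact: dvdp_map.
by apply/eqP; rewrite eqn_leq ge leqnn -ge leqnn.
Qed.

End MultiplicityComplements.

(** In the polynomial ring in y over K(x), the multiplicity of the root y = c in
    a(x) f(y) is that of c in f. *)
Lemma power_free (K : fieldType) (d : nat) (a f : {poly K}) (s : nat)
    (w : {fraction {poly {poly K}}}) :
    (0 < d)%N -> a != 0 -> f != 0 ->
    w ^+ d = FracField.tofrac (a%:P * map_poly polyC f) ^+ s ->
  forall c, (d %| s * mup c f)%N.
Proof.
move=> d0 a0 f0 wE c.
have [n [m [m0 wm]]] := fraction_ratio w.
set u := a%:P * _ in wE.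
have {wE wm} nm : n ^+ d = u ^+ s * m ^+ d.
  apply/eqP; rewrite -(tofrac_eq (n ^+ d)) rmorphM !rmorphXn /= -wm exprMn wE.
  exact: eqxx.
pose psi := map_poly (@FracField.tofrac {poly K}).
have inj (p : {poly {poly K}}) : (psi p == 0) = (p == 0).
  apply/eqP/eqP => [E|->]; last exact: rmorph0.
  apply/polyP => i; apply/eqP; rewrite coef0 -tofrac_eq0 -[FracField.tofrac _]coef_map.
  by rewrite -/psi E coef0.
have f0' : map_poly polyC f != 0 by rewrite map_polyC_eq0.
have u0 : u != 0 by rewrite mulf_neq0 ?polyC_eq0.
have n0 : n != 0.
  apply/negP => /eqP n0; move: nm; rewrite n0 expr0n gtn_eqF // => /esym/eqP.
  by rewrite mulf_eq0 !expf_eq0 (negbTE u0) (negbTE m0) !andbF.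
have := congr1 (fun p => mup (FracField.tofrac c%:P) (psi p)) nm.
rewrite /= /psi rmorphM !rmorphXn /= -/psi mupM ?expf_neq0 ?inj // !mupX ?inj //.
have -> : mup (FracField.tofrac c%:P) (psi u) = mup c f.
  rewrite /u /psi rmorphM /= map_polyC /= mupMr; last first.
    by rewrite rootC tofrac_eq0.
  rewrite -map_poly_comp /=.
  pose phi : {rmorphism K -> {fraction {poly K}}} :=
    (@FracField.tofrac {poly K}) \o polyC.
  exact: (mup_map phi c f0).
move=> E; have : (d %| s * mup c f + d * mup (FracField.tofrac c%:P) (psi m))%N.
  by rewrite -E dvdn_mulr.
by rewrite dvdn_addl // dvdn_mulr.
Qed.

(** With E = f^(g+1) and Q = d g + 1, one has E^d = f(x)^(d-1) f(x^Q), which is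
    the value at y = x^Q of u = f(x)^(d-1) f(y).  A relation between the powers
    of E with coefficients in x and x^Q forces the resultant in Z of
    sum_i R_i Z^i and Z^d - u to vanish at y = x^Q, hence identically, because
    its degree in x is less than Q.  But Z^d - u has no factor of degree
    between 1 and d - 1 over K(x, y): such a factor would make u^s a d-th power
    for some 0 < s < d, and the multiplicities of the roots of f exclude this. *)
Lemma twisted_powers_free (K : fieldType) (d g Q D A : nat) (f : {poly K})
    (R : nat -> {poly {poly K}}) :
    (0 < d)%N -> Q = (d * g + 1)%N -> f != 0 -> f \Po 'X^Q = f ^+ Q ->
    (forall s, (forall c, d %| s * mup c f)%N -> (d %| s)%N) ->
    (size f <= D.+1)%N -> (forall i, coefs_below A (R i)) ->
    (2 * d * (A + d * D) < Q)%N ->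
    \sum_(i < d) (R i).['X^Q] * (f ^+ g.+1) ^+ i = 0 ->
  forall i, (i < d)%N -> R i = 0.
Proof.
move=> d0 QE f0 fQ gcd_f szf HR ltQ sum0.
pose u := (f ^+ d.-1)%:P * map_poly polyC f.
pose E := f ^+ g.+1.
have uE : u.['X^Q] = E ^+ d.
  rewrite /u hornerCM -[(map_poly _ f).[_]]/(f \Po 'X^Q) fQ -exprD -exprM;
    congr (_ ^+ _).
  by case: (d) d0 QE => // d' _ ->; rewrite /=; lia.
pose G : {poly {poly {poly K}}} := \poly_(i < d) R i.
pose H : {poly {poly {poly K}}} := 'X^d - u%:P.
suff : G = 0.
  by move=> G0 i ltid; have := congr1 (fun p : {poly {poly {poly K}}} => p`_i) G0;
    rewrite coef_poly ltid coef0.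
have szG : (size G <= d)%N by apply: size_poly.
have cohG i : coefs_below A G`_i.
  by rewrite coef_poly; case: ifP => _; [apply: HR | apply: coefs_below0].
have szH : size H = d.+1 by rewrite /H size_XnsubC.
pose ev (p : {poly {poly {poly K}}}) := (map_poly (horner_eval 'X^Q) p).[E].
have evG : ev G = 0.
  rewrite /ev (horner_coef_wide _ (n := d)); last by rewrite (leq_trans (size_poly _
    _)).
  rewrite -[RHS]sum0; apply: eq_bigr => i _; congr (_ * _).
  by rewrite coef_map /= coef_poly ltn_ord /horner_eval.
have evH : ev H = 0.
  by rewrite /ev rmorphB /= map_polyXn map_polyC /= /horner_eval uE !hornerE subrr.
have [szG1|szG1] := leqP (size G) 1.
  have GE : G = (G`_0)%:P by apply: size1_polyC.
  rewrite GE; apply/eqP; rewrite polyC_eq0; apply/eqP.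
  apply: (@coefs_below_subst_eq0 _ A Q) => //.
    apply: leq_ltn_trans ltQ; rewrite (leq_trans (leq_addr (d * D) A)) //.
    by rewrite leq_pmull // muln_gt0.
  by move: evG; rewrite /ev {1}GE map_polyC hornerC => E0; exact: E0.
have [||[a b] _ res_ideal] := @resultant_in_ideal _ G H.
- by [].
- by rewrite szH.
have res0 : resultant G H = 0.
  apply: (@coefs_below_subst_eq0 _ (2 * d * (A + d * D)) Q) => //; last first.
    have := congr1 ev res_ideal; rewrite /ev map_polyC hornerC => /= E1;
      apply: etrans E1 _.
    by rewrite rmorphD !rmorphM /= hornerD !hornerM -/(ev _) -[(map_poly _ H).[_]]/(ev
      H) -[(map_poly _ G).[_]]/(ev G) evG evH !mulr0 addr0.
  apply: (@coefs_belowW _ (((size H).-1 + (size G).-1) * (A + d * D))).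
    by rewrite leq_mul2r; apply/orP; right; rewrite szH; lia.
  have bu : coefs_below (A + d * D) u.
    apply: (@coefs_belowW _ (d.-1 * D + 0)); first by nia.
    apply: coefs_belowM (coefs_below_map _ _); apply: coefs_belowC.
    have [->|f'] := eqVneq d.-1 0%N; first by rewrite expr0 size_poly1.
    rewrite (leq_trans (size_poly_exp_leq _ _)) //.
    have : ((size f).-1 * d.-1 <= d.-1 * D)%N by rewrite mulnC leq_mul2l; apply/orP;
      right; lia.
    by [].
  apply: coefs_below_det => i j; rewrite Sylvester_mxE.
  case: (split i) => k; case: leqP => _; rewrite ?mulr0n ?mulr1n;
    try exact: coefs_below0.
  - by apply: coefs_belowW (cohG _); lia.
  - rewrite /H coefB coefXn coefC; apply: coefs_belowD; last first.
      by apply: coefs_belowN; case: eqP => // _; apply: coefs_below0.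
    case: (_ == _); last exact: coefs_below0.
    by rewrite mulr1n -polyC1; apply: coefs_belowC; rewrite size_poly1.
have tf0 (x : {poly {poly K}}) : (FracField.tofrac x == 0) =
  (x == 0) by apply: tofrac_eq0.
have G0 : G != 0 by rewrite -size_poly_gt0 ltnW.
pose G' := map_poly (@FracField.tofrac {poly {poly K}}) G.
pose H' := map_poly (@FracField.tofrac {poly {poly K}}) H.
have szG' : size G' = size G by rewrite size_map_poly_id0 // tf0 lead_coef_eq0.
have H'E : H' = 'X^d - (FracField.tofrac u)%:P.
  by rewrite /H' rmorphB /= map_polyXn map_polyC.
have res0' : resultant G' H' == 0.
  rewrite -map_resultant ?res0 ?rmorph0 //= tf0 lead_coef_eq0 //.
  by rewrite -size_poly_gt0 szH.
have G'0 : G' != 0 by rewrite -size_poly_gt0 szG' ltnW.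
have [] := @binomial_factor_norm _ d (FracField.tofrac u) (gcdp G' H').
- rewrite -resultant_eq0 res0' /= (leq_trans (dvdp_leq _ (dvdp_gcdl _ _))) //.
  by rewrite szG'.
- by rewrite -H'E dvdp_gcdr.
move=> s [w [/andP[s0 sd] wE]].
have := gcd_f s (power_free d0 (expf_neq0 _ f0) f0 wE).
by move=> /(dvdn_leq s0); rewrite leqNgt sd.
Qed.

(** * Stepanov's method *)

Lemma nderivnM (A : comNzRingType) (p q : {poly A}) k :
  (p * q)^`N(k) = \sum_(s < k.+1) p^`N(s) * q^`N(k - s).
Proof.
elim/poly_ind: p k => [|p c IH] k.
  by rewrite mul0r linear0 big1 // => s _; rewrite linear0 mul0r.
have XP (r : {poly A}) n : (r * 'X)^`N(n) = (if n is n'.+1 then r^`N(n') else 0) +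
  r^`N(n) * 'X.
  case: n => [|n]; first by rewrite !nderivn0 add0r.
  by rewrite -[r * 'X]addr0 -[0]/(0%:P) nderivnMXaddC.
have CP (r : {poly A}) n : (c%:P * r)^`N(n) = c%:P * r^`N(n) by rewrite !mul_polyC
  linearZ.
have CC n : (c%:P)^`N(n) = (if n is n'.+1 then 0 else c%:P) by rewrite nderivnC;
  case: n.
rewrite mulrDl linearD /= CP mulrAC XP.
under [RHS]eq_bigr do rewrite linearD /= XP CC !mulrDl.
rewrite !big_split /= big_ord_recl /= mul0r add0r.
rewrite IH mulr_suml [in LHS]addrAC -!addrA; congr (_ + _).
  case: k => [|k]; first by rewrite big_ord0.
  by rewrite IH; apply: eq_bigr => s _; rewrite /bump /= add1n subSS.
rewrite addrC; congr (_ + _); first by apply: eq_bigr => s _; rewrite mulrAC.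
by rewrite big_ord_recl big1 /= ?addr0 ?subn0 // => s _; rewrite mul0r.
Qed.

Lemma size_nderivn (A : nzSemiRingType) (p : {poly A}) k :
  (size p^`N(k) <= size p - k)%N.
Proof. exact: size_poly. Qed.

(** Taylor expansion at a. *)
Lemma dvdp_of_nderivn (K : fieldType) (p : {poly K}) (a : K) l :
  (forall k, (k < l)%N -> (p^`N(k)).[a] = 0) -> ('X - a%:P) ^+ l %| p.
Proof.
move=> H; have E : p = \sum_(i < size p) (p^`N(i)).[a] *: ('X - a%:P) ^+ i.
  have Ec : p = (p^:P).[a%:P + ('X - a%:P)] by rewrite addrC subrK -[LHS]comp_polyXr.
  rewrite {1}Ec nderiv_taylor; last exact: mulrC.
  rewrite size_map_polyC; apply: eq_bigr => i _.
  by rewrite nderivn_map /= horner_map /= mul_polyC.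
rewrite [X in _ %| X]E; elim/big_rec: _ => [|i q _ Hq]; first exact: dvdp0.
rewrite dvdp_add //; have [lt|le] := ltnP i l; first by rewrite H // scale0r dvdp0.
by rewrite -mul_polyC dvdp_mull ?dvdp_exp2l.
Qed.

Lemma dvdp_prod_XsubC_exp (K : fieldType) (R : {poly K}) (xs : seq K) l :
  uniq xs -> (forall a, a \in xs -> ('X - a%:P) ^+ l %| R) ->
  \prod_(a <- xs) ('X - a%:P) ^+ l %| R.
Proof.
elim: xs => [|a xs IH] /=; first by rewrite big_nil dvd1p.
move=> /andP[aN un] H; rewrite big_cons Gauss_dvdp; last first.
  rewrite prodrXl; apply/coprimep_expl/coprimep_expr.
  by rewrite coprimep_sym coprimep_XsubC root_prod_XsubC.
by rewrite H ?mem_head //= IH // => b bxs; rewrite H // inE bxs orbT.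
Qed.

Lemma homogeneous_solution (K : fieldType) (I J : finType) (M : I -> J -> K) :
  (#|J| < #|I|)%N ->
  exists v : I -> K, (exists i, v i != 0) /\ forall j, \sum_i v i * M i j = 0.
Proof.
move=> lt; pose MM := \matrix_(i < #|I|, j < #|J|) M (enum_val i) (enum_val j).
have : kermx MM != 0.
  rewrite -mxrank_eq0 mxrank_ker subn_eq0 -ltnNge.
  exact: leq_ltn_trans (rank_leq_col _) lt.
case/rowV0Pn => v /sub_kermxP vM v0.
exists (fun i => v 0 (enum_rank i)); split.
  case/rV0Pn: v0 => i vi; exists (enum_val i); by rewrite enum_valK.
move=> j; have := congr1 (fun w : 'rV_ _ => w 0 (enum_rank j)) vM.
rewrite !mxE => vMj; rewrite -[RHS]vMj (reindex (fun k : 'I_#|I| => enum_val k)) /=;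
  last first.
  by exists enum_rank => i _; rewrite ?enum_valK ?enum_rankK.
by apply: eq_bigr => i _; rewrite mxE enum_valK enum_rankK.
Qed.

Section PowerDerivatives.
Variables (K : fieldType) (f : {poly K}).

(** The k-th Hasse derivative of f ^ N is f ^ (N - k) times a polynomial of
    degree at most k (deg f - 1); these cofactors are computed by recursion
    on N.  The truncated subtraction N - k is avoided by multiplying with f ^ k
    instead. *)
Fixpoint power_nderiv (N k : nat) : {poly K} :=
  if N is N'.+1 then
    power_nderiv N' k + \sum_(i < k) f^`N(i.+1) * f ^+ i * power_nderiv N' (k - i.+1)
  else (k == 0%N)%:R.

Lemma power_nderivP N k : f ^+ k * (f ^+ N)^`N(k) = f ^+ N * power_nderiv N k.
Proof.
elim: N k => [|N IH] k /=.
  by rewrite expr0 mul1r -polyC1 nderivnC; case: k => [|k];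
    rewrite ?mulr0 // expr0 mul1r.
rewrite exprS nderivnM mulr_sumr big_ord_recl /= nderivn0 subn0 mulrDr.
congr (_ + _); first by rewrite mulrCA IH mulrA.
rewrite mulr_sumr; apply: eq_bigr => i _; rewrite /bump /= add1n.
have -> : f ^+ k = f ^+ i.+1 * f ^+ (k - i.+1) by rewrite -exprD subnKC.
by rewrite mulrACA IH exprS; ring.
Qed.

Lemma size_power_nderiv D N k : (size f <= D.+1)%N ->
  (size (power_nderiv N k) <= (k * D).+1)%N.
Proof.
move=> szf; elim: N k => [|N IH] k /=.
  by case: (k == 0%N); rewrite ?size_poly1 ?size_poly0.
rewrite (leq_trans (size_polyD _ _)) // geq_max IH /=.
rewrite (leq_trans (size_sum _ _ _)) //; apply/bigmax_leqP => i _.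
have h1 : (size (f^`N(i.+1)) <= D.+1)%N by rewrite (leq_trans (size_nderivn _ _)) //
  (leq_trans (leq_subr _ _)).
have h2 : (size (f ^+ i) <= (i * D).+1)%N.
  rewrite (leq_trans (size_poly_exp_leq _ _)) // ltnS mulnC leq_mul2l; apply/orP;
    right; lia.
have h3 := IH (k - i.+1)%N.
rewrite (leq_trans (size_polyMleq _ _)) //.
have h4 := size_polyMleq (f^`N(i.+1)) (f ^+ i).
have : (i.+1 * D + (k - i.+1) * D = k * D)%N by rewrite -mulnDl subnKC.
by rewrite mulSn; lia.
Qed.

(** The analogous cofactor for the Hasse derivatives of r * f ^ N. *)
Definition mul_power_nderiv (N k : nat) (r : {poly K}) : {poly K} :=
  \sum_(s < k.+1) r^`N(s) * f ^+ s * power_nderiv N (k - s).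

Lemma mul_power_nderivP N k r :
  f ^+ k * (r * f ^+ N)^`N(k) = f ^+ N * mul_power_nderiv N k r.
Proof.
rewrite nderivnM !mulr_sumr; apply: eq_bigr => s _.
have -> : f ^+ k = f ^+ s * f ^+ (k - s) by rewrite -exprD subnKC // -ltnS.
by rewrite mulrACA power_nderivP; ring.
Qed.

Lemma size_mul_power_nderiv D A N k (r : {poly K}) : (size f <= D.+1)%N ->
  (size r <= A)%N ->
  (size (mul_power_nderiv N k r) <= A + k * D)%N.
Proof.
move=> szf szr.
rewrite (leq_trans (size_sum _ _ _)) //; apply/bigmax_leqP => s _.
have [->|r0] := eqVneq (r^`N(s)) 0; first by rewrite !mul0r size_poly0.
have h1 : (size (r^`N(s)) <= A)%N by rewrite (leq_trans (size_nderivn _ _)) //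
  (leq_trans (leq_subr _ _)).
have h0 : (0 < size (r^`N(s)))%N by rewrite size_poly_gt0.
have h2 : (size (f ^+ s) <= (s * D).+1)%N.
  rewrite (leq_trans (size_poly_exp_leq _ _)) // ltnS mulnC leq_mul2l; apply/orP;
    right; lia.
have h3 := @size_power_nderiv D N (k - s) szf.
rewrite (leq_trans (size_polyMleq _ _)) //.
have h4 := size_polyMleq (r^`N(s)) (f ^+ s).
have : (s * D + (k - s) * D = k * D)%N by rewrite -mulnDl subnKC // -ltnS.
lia.
Qed.

End PowerDerivatives.

(** Stepanov's auxiliary polynomial R is a combination of the x^t E^i x^(jQ),
    with E = f^(g+1), i < d, j < J and t < A, that vanishes to order l at all the
    points of xs.  At such a point a, the factor x^(jQ) agrees with a^j to order
    Q and E(a) = beta f(a), so that each of the l derivative conditions says that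
    one polynomial of small degree in a is zero.  This makes fewer than d J A
    linear equations, so there is a solution, and R is nonzero by
    [twisted_powers_free].  The degree of R bounds l times the number of
    points. *)
Lemma stepanov_bound (K : fieldType) (d g Q D A J l : nat) (f : {poly K})
    (beta : K) (xs : seq K) :
    [pchar K].-nat Q -> (0 < d)%N -> Q = (d * g + 1)%N ->
    f != 0 -> f \Po 'X^Q = f ^+ Q ->
    (forall s, (forall c, d %| s * mup c f)%N -> (d %| s)%N) ->
    (size f <= D.+1)%N -> (l <= Q)%N -> (2 * d * (A + d * D) < Q)%N ->
    (l * (A + l * D + d * D + J) < d * J * A)%N ->
    uniq xs ->
    (forall a, a \in xs -> [/\ a ^+ Q = a, f.[a] != 0 & f.[a] ^+ g = beta]) ->
  (l * size xs <= A + d * g.+1 * D + J * Q)%N.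
Proof.
move=> charQ d0 QE f0 fQ gcd_f szf lQ ltQ lt_eqs uniq_xs Hxs.
set B := (A + l * D + d * D + J)%N in lt_eqs.
pose I := ('I_d * ('I_J * 'I_A))%type.
pose E := f ^+ g.+1.
have szfX i : (size (f ^+ i) <= (i * D).+1)%N.
  rewrite (leq_trans (size_poly_exp_leq _ _)) // ltnS mulnC leq_mul2l; apply/orP;
    right; lia.
pose cond (k : nat) (x : I) : {poly K} :=
  beta ^+ x.1 *: (f ^+ x.1 * 'X^(x.2.1) * mul_power_nderiv f (g.+1 * x.1) k 'X^(x.2.2)).
have sz_cond k (x : I) : (k < l)%N -> (size (cond k x) <= B)%N.
  move=> ltkl; rewrite (leq_trans (size_scale_leq _ _)) //.
  case: x => [[i ilt] [[j jlt] [t tlt]]] /=.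
  have h1 : (size (mul_power_nderiv f (g.+1 * i) k 'X^t) <= A + k * D)%N.
    by apply: size_mul_power_nderiv szf _; rewrite size_polyXn.
  have h2 := size_polyMleq (f ^+ i * 'X^j) (mul_power_nderiv f (g.+1 * i) k 'X^t).
  have h3 := size_polyMleq (f ^+ i) ('X^j : {poly K}).
  have h4 := szfX i.
  have h5 : (i * D <= d * D)%N by rewrite leq_mul2r ltnW ?orbT.
  have h6 : (k * D <= l * D)%N by rewrite leq_mul2r ltnW ?orbT.
  move: h3; rewrite size_polyXn => h3.
  by rewrite (leq_trans h2) // /B; lia.
have [|v [[x0 vx0] v_eqs]] :=
    @homogeneous_solution K I ('I_l * 'I_B)%type (fun x y => (cond y.1 x)`_y.2).
  by rewrite !card_prod !card_ord mulnA.
have cond0 k : (k < l)%N -> \sum_(x : I) v x *: cond k x = 0.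
  move=> ltkl; apply/polyP => e; rewrite coef0 coef_sum.
  have [lteB|leBe] := ltnP e B.
    rewrite -[RHS](v_eqs (Ordinal ltkl, Ordinal lteB)).
    by apply: eq_bigr => x _; rewrite coefZ.
  apply: big1 => x _; rewrite coefZ nth_default ?mulr0 //.
  exact: leq_trans (sz_cond _ _ ltkl) leBe.
pose R := \sum_(x : I) v x *: ('X^(x.2.2) * E ^+ x.1 * 'X^(x.2.1 * Q)).
pose Ri (i : nat) : {poly {poly K}} :=
  \sum_(x : I | x.1 == i :> nat) (v x *: 'X^(x.2.2))%:P * 'X^(x.2.1).
have sumRi : \sum_(i < d) (Ri i).['X^Q] * E ^+ i = R.
  rewrite /R (partition_big (fun x : I => x.1) xpredT) //=.
  apply: eq_bigr => i _; rewrite /Ri horner_sum mulr_suml.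
  apply: eq_bigr => x /eqP <-.
  by rewrite !hornerE -exprM [(Q * _)%N]mulnC -!scalerAl mulrAC.
have R0 : R != 0.
  apply/eqP => R0; move: sumRi; rewrite R0 => /(twisted_powers_free (A :=
    A) d0 QE f0 fQ gcd_f szf) H.
  have {}H := H _ ltQ x0.1 (ltn_ord _).
  have /H : forall i, coefs_below A (Ri i).
    move=> i; apply: coefs_below_sum => x _.
    apply: (@coefs_belowW _ (A + 0)); first by rewrite addn0.
    apply: coefs_belowM.
      apply: coefs_belowC; rewrite (leq_trans (size_scale_leq _ _)) // size_polyXn.
      by rewrite ltnS ltnW.
    by rewrite -(map_polyXn (@polyC K)); apply: coefs_below_map.
  move/(congr1 (fun p : {poly {poly K}} => (p`_x0.2.1)`_x0.2.2)).
  rewrite /Ri coef_sum !coef0 coef_sum (bigD1 x0) //= big1.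
    rewrite coefCM coefXn eqxx mulr1 coefZ coefXn eqxx mulr1 addr0 => v0.
    by rewrite v0 eqxx in vx0.
  move=> x /andP[x1 xx0]; rewrite coefCM coefXn.
  case: (altP (x0.2.1 =P x.2.1 :> nat)) => [E1|_]; last by rewrite mulr0 coef0.
  rewrite mulr1 coefZ coefXn; case: (altP (x0.2.2 =P x.2.2 :> nat)) => [E2|_];
    last by rewrite mulr0.
  case/negP: xx0; case: x x1 E1 E2 => [i [j t]] /= /eqP E0 E1 E2.
  by case: (x0) E0 E1 E2 => [i' [j' t']] /= /val_inj -> /val_inj -> /val_inj ->.
(* Modulo (X - a)^Q, the factor X^(jQ) is the constant a^j; this leaves the
   combination Rt of products x^t E^i. *)
have dvdR a : a \in xs -> ('X - a%:P) ^+ l %| R.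
  move=> /Hxs [aQ fa0 fag].
  pose Rt := \sum_(x : I) (v x * a ^+ x.2.1) *: ('X^(x.2.2) * E ^+ x.1).
  have -> : R = (R - Rt) + Rt by rewrite subrK.
  apply: dvdp_add.
    rewrite /R /Rt -sumrB; elim/big_rec: _ => [|x p _ Hp]; first exact: dvdp0.
    apply: dvdp_add Hp.
    apply: (dvdp_trans (dvdp_exp2l _ lQ)).
    have -> : ('X - a%:P) ^+ Q = 'X^Q - (a%:P) ^+ Q.
      have cQ : [pchar {poly K}].-nat Q.
        by rewrite (eq_pnat _ (pchar_poly K)).
      by rewrite exprDn_pchar // exprNn_pchar.
    have -> : v x *: ('X^(x.2.2) * E ^+ x.1 * 'X^(x.2.1 * Q)) - (v x * a ^+ x.2.1) *:
      ('X^(x.2.2) * E ^+ x.1)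
       = (v x *: ('X^(x.2.2) * E ^+ x.1)) * (('X^Q) ^+ x.2.1 - (a%:P ^+ Q) ^+ x.2.1).
      rewrite mulrBr -!polyC_exp aQ -exprM [(Q * _)%N]mulnC -!scalerAl; congr (_ - _).
      by rewrite -scalerA [_ * (_)%:P]mulrC mul_polyC.
    by rewrite [X in _ %| _ * X]subrXX dvdp_mull // dvdp_mulr.
  apply: dvdp_of_nderivn => k ltkl.
  apply: (mulfI (expf_neq0 k fa0)); rewrite mulr0.
  rewrite -horner_exp -hornerM -[RHS](horner0 a) -(cond0 _ ltkl).
  rewrite /Rt linear_sum /= mulr_sumr !horner_sum; apply: eq_bigr => x _.
  rewrite linearZ /= -scalerAr !hornerZ -(mulrA (v x)); congr (_ * _).
  rewrite /E -exprM mul_power_nderivP !hornerM !hornerXn !horner_exp.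
  by rewrite exprM exprSr fag exprMn; ring.
have szR : (size R <= A + d * g.+1 * D + J * Q)%N.
  rewrite (leq_trans (size_sum _ _ _)) //; apply/bigmax_leqP => x _.
  rewrite (leq_trans (size_scale_leq _ _)) //.
  case: x => [[i ilt] [[j jlt] [t tlt]]] /=.
  have h1 := size_polyMleq ('X^t * E ^+ i) ('X^(j * Q) : {poly K}).
  have h2 := size_polyMleq ('X^t : {poly K}) (E ^+ i).
  have h3 : (size (E ^+ i) <= (g.+1 * i * D).+1)%N by rewrite /E -exprM.
  have h4 : (g.+1 * i * D <= d * g.+1 * D)%N by rewrite leq_mul2r (mulnC d) leq_mul2l
    (ltnW ilt) !orbT.
  have h5 : (j * Q <= J * Q)%N by rewrite leq_mul2r (ltnW jlt) orbT.
  move: h1 h2; rewrite !size_polyXn => h1 h2.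
  apply: (leq_trans h1); rewrite addnS /= leq_add //.
  by apply: (leq_trans h2); move: h3 h4; rewrite addSn /=;
    move: (d * g.+1 * D)%N (g.+1 * i * D)%N (size _) => u1 u2 u3; lia.
have := dvdp_leq R0 (dvdp_prod_XsubC_exp uniq_xs dvdR).
rewrite prodrXl => szP; rewrite (leq_trans _ szR) // (leq_trans _ szP) //.
have := size_exp (\prod_(a <- xs) ('X - a%:P)) l.
by rewrite size_prod_XsubC /= mulnC => <-; apply: leq_pred.
Qed.

(** Asymptotic form of [stepanov_bound] for Q = P^2: the d level sets of f^g have
    at most Q / d + O(P) points each, with a constant that depends only on d and
    on the degree of f.  The parameters are A ~ Q / (4d), J = P and l = d P - c,
    with a constant c large enough for the linear system to be
    underdetermined. *)
Lemma level_set_bound (d D : nat) : (0 < d)%N -> exists C P0 : nat,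
  forall (K : fieldType) (g P : nat) (f : {poly K}) (beta : K) (xs : seq K),
    let Q := (P * P)%N in
    (P0 <= P)%N -> [pchar K].-nat Q -> Q = (d * g + 1)%N ->
    f != 0 -> f \Po 'X^Q = f ^+ Q ->
    (forall s, (forall c, d %| s * mup c f)%N -> (d %| s)%N) ->
    (size f <= D.+1)%N -> uniq xs ->
    (forall a, a \in xs -> [/\ a ^+ Q = a, f.[a] != 0 & f.[a] ^+ g = beta]) ->
  (d * size xs <= Q + C * P)%N.
Proof.
move=> d0.
have [w wE] : exists w, w = (2 * d * D + 1)%N by eexists.
have [c cE] : exists c, c = (8 * d * (d * w + 1))%N by eexists.
have [C CE] : exists C, C = (2 * (c + d * (2 * D + 1)) + 1)%N by eexists.
exists C, (2 * c + 8 * d + 4 * d * d * D + 1)%N.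
move=> K g P f beta xs; set Q := (P * P)%N => /= leP charQ QE f0 fQ gcd_f szf un Hxs.
have PQ : (P * P = Q)%N by [].
have leQ : (P <= Q)%N by rewrite -PQ leq_pmulr //; lia.
move: (Q) PQ leQ charQ QE fQ Hxs => {}Q PQ leQ charQ QE fQ Hxs.
have Q0 : (0 < Q)%N by rewrite (leq_trans _ leQ) //; lia.
have [A A1 A2] : exists2 A, (A * (4 * d) <= Q)%N & (Q < (A + 1) * (4 * d))%N.
  exists (Q %/ (4 * d))%N; first exact: leq_trunc_div.
  by rewrite addn1; apply: ltn_ceil; rewrite muln_gt0 d0.
have Pd : (c <= d * P)%N by rewrite (@leq_trans P) ?leq_pmull //; lia.
have := @stepanov_bound K d g Q D A P (d * P - c) f beta xs charQ d0 QE f0 fQ gcd_f szf.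
have h1 : (d * P - c <= Q)%N.
  rewrite (leq_trans (leq_subr _ _)) // -PQ leq_mul2r; apply/orP; right; lia.
have h2 : (2 * d * (A + d * D) < Q)%N.
  have : (4 * d * d * D < Q)%N by apply: leq_trans leQ; lia.
  by move: A1; lia.
move=> /(_ h1 h2) {h1 h2}.
pose X := ((d * P - c) * D + d * D + P)%N.
have hX : (X <= P * w)%N.
  have : ((d * P - c) * D <= d * P * D)%N by rewrite leq_mul2r leq_subr orbT.
  have : (d * D <= d * D * P)%N by rewrite leq_pmulr //; lia.
  by rewrite /X wE; lia.
have h3 : ((d * P - c) * (A + (d * P - c) * D + d * D + P) < d * P * A)%N.
  have -> : (A + (d * P - c) * D + d * D + P = A + X)%N by rewrite /X; lia.
  have e1 : ((d * P - c) * X <= d * w * Q)%N.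
    rewrite (leq_trans (leq_mul (leq_subr c (d * P)) hX)) // -PQ; lia.
  have e2 : (d * w * Q < c * A)%N.
    have Q8 : (Q <= A * (8 * d))%N.
      have : (8 * d <= Q)%N by apply: leq_trans leQ; lia.
      by move: A2; lia.
    have A0 : (0 < A)%N by rewrite lt0n; apply/eqP => A0; move: Q8 leQ leP;
      rewrite A0; lia.
    have -> : (c * A = (d * w + 1) * (A * (8 * d)))%N by rewrite cE; lia.
    have : (Q * (d * w + 1) <= A * (8 * d) * (d * w + 1))%N by rewrite leq_mul2r Q8
      orbT.
    lia.
  have e3 : (c * A <= d * P * A)%N by rewrite leq_mul2r Pd orbT.
  have : ((d * P - c) * (A + X) = d * P * A - c * A + (d * P - c) * X)%N.
    by rewrite mulnDr mulnBl.
  lia.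
move=> /(_ h3 un Hxs) {h3}.
set N := size xs => bound.
rewrite leqNgt; apply/negP => contra.
have b1 : ((d * P - c) * N <= Q * (P + 2 * D + 1))%N.
  apply: (leq_trans bound).
  have AQ : (A <= Q)%N by rewrite (leq_trans _ A1) // leq_pmulr // muln_gt0 d0.
  have dg : (d * g.+1 <= 2 * Q)%N.
    have : (d <= Q)%N by apply: leq_trans leQ; lia.
    by rewrite QE; lia.
  have : (d * g.+1 * D <= 2 * Q * D)%N by rewrite leq_mul2r dg orbT.
  lia.
have b2 : ((d * P - c) * (Q + C * P) <= (d * P - c) * (d * N))%N.
  by rewrite leq_mul2l (ltnW contra) orbT.
have b3 : ((d * P - c) * (d * N) <= d * (Q * (P + 2 * D + 1)))%N.
  by rewrite mulnCA leq_mul2l b1 orbT.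
have b4 := leq_trans b2 b3.
have b5 : ((d * P - c) * (Q + C * P) + c * (Q + C * P) = d * P * (Q + C * P))%N.
  by rewrite -mulnDl subnK.
have b6 : (d * P * (Q + C * P) = d * P * Q + d * C * Q)%N by rewrite -PQ; lia.
have b7 : (d * C * Q <= c * Q + c * C * P + d * Q * (2 * D + 1))%N.
  move: b4 b5; rewrite b6; lia.
have b8 : (2 * (c * C * P) <= C * Q)%N.
  have -> : (2 * (c * C * P) = C * (2 * c * P))%N by lia.
  rewrite leq_mul2l -PQ leq_mul2r; apply/orP; right; apply/orP; right; lia.
have b9 : (C * Q <= d * C * Q)%N by rewrite -mulnA leq_pmull.
have : (C * Q <= 2 * (c * Q) + 2 * (d * Q * (2 * D + 1)))%N by lia.
by rewrite CE; lia.
Qed.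

(** * Character sums over large extension fields *)

Lemma prim_root_neq0 (A : fieldType) d (z : A) : d.-primitive_root z -> z != 0.
Proof.
move=> prim_z; apply/eqP => z0; have := prim_expr_order prim_z.
by rewrite z0 expr0n gtn_eqF ?(prim_order_gt0 prim_z) // => /esym/eqP; rewrite oner_eq0.
Qed.

Section RootCharacter.
Variables (K : fieldType) (d : nat) (eps : K) (w : algC).

(** The isomorphism eps ^ j |-> w ^ j between groups of d-th roots of unity,
    extended by 0.  Being a finite sum of indicators, it needs no logarithm and
    is zero outside the group. *)
Definition root_char (z : K) : algC := \sum_(j < d) (z == eps ^+ j)%:R * w ^+ j.

Hypotheses (prim_eps : d.-primitive_root eps) (prim_w : d.-primitive_root w).

Let d_gt0 : (0 < d)%N := prim_order_gt0 prim_eps.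

Lemma root_charX j : root_char (eps ^+ j) = w ^+ j.
Proof.
rewrite /root_char (bigD1 (Ordinal (ltn_pmod j d_gt0))) //= (prim_expr_mod prim_eps).
rewrite eqxx mul1r (prim_expr_mod prim_w) big1 ?addr0 // => i neq.
rewrite (eq_prim_root_expr prim_eps) eq_sym modn_small //.
case: eqP => [E|]; last by rewrite mul0r.
by case/eqP: neq; apply: val_inj.
Qed.

Lemma root_char1 : root_char 1 = 1.
Proof. by rewrite -(expr0 eps) root_charX. Qed.

Lemma root_char0 : root_char 0 = 0.
Proof.
apply: big1 => j _; rewrite eq_sym expf_eq0 (negPf (prim_root_neq0 prim_eps)).
by rewrite andbF mul0r.
Qed.

Lemma root_charM z z' : (z == 0) || (z ^+ d == 1) -> (z' == 0) || (z' ^+ d == 1) ->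
  root_char (z * z') = root_char z * root_char z'.
Proof.
case/orP => [/eqP-> _|/eqP/(prim_rootP prim_eps)[i ->]];
  first by rewrite mul0r root_char0 mul0r.
case/orP => [/eqP->|/eqP/(prim_rootP prim_eps)[j ->]];
  first by rewrite mulr0 root_char0 mulr0.
by rewrite -exprD !root_charX exprD.
Qed.

End RootCharacter.

Lemma normr_prim_root d (w : algC) : d.-primitive_root w -> `|w| = 1.
Proof.
move=> prim_w; have d0 := prim_order_gt0 prim_w.
apply/eqP; rewrite -(@pexpr_eq1 _ _ d) //.
by rewrite -normrX (prim_expr_order prim_w) normr1.
Qed.

Lemma sum_prim_root d (w : algC) : (1 < d)%N -> d.-primitive_root w ->
  \sum_(j < d) w ^+ j = 0.
Proof.
move=> d1 prim_w; have := subrX1 w d; rewrite (prim_expr_order prim_w) subrr =>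
  /esym/eqP.
rewrite mulf_eq0 subr_eq0 => /orP[/eqP w1|/eqP //].
have := prim_order_dvd prim_w 1; rewrite expr1 w1 eqxx dvdn1; case: eqP => // dE.
by rewrite dE in d1.
Qed.

(** The upper bounds of [level_set_bound] on the d level sets add up to the number
    of points up to O(P), so that each level set has Q / d + O(P) points. *)
Lemma extension_sum_bound (d D : nat) : (1 < d)%N -> exists C P0 : nat,
  forall (K : fieldType) (eps : K) (w : algC) (g P : nat) (f : {poly K}) (xs : seq K),
    let Q := (P * P)%N in
    d.-primitive_root eps -> d.-primitive_root w ->
    (P0 <= P)%N -> [pchar K].-nat Q -> Q = (d * g + 1)%N ->
    f != 0 -> f \Po 'X^Q = f ^+ Q ->
    (forall s, (forall c, d %| s * mup c f)%N -> (d %| s)%N) ->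
    (size f <= D.+1)%N -> uniq xs -> size xs = Q ->
    (forall a, a \in xs -> a ^+ Q = a) ->
  `|\sum_(a <- xs) root_char d eps w (f.[a] ^+ g)| <= C%:R * P%:R.
Proof.
move=> d1; have d0 := ltnW d1; have [C [P0 HC]] := level_set_bound D d0.
exists (C + D)%N, (P0 + 2)%N => K eps w g P f xs; set Q := (P * P)%N.
move=> /= prim_eps prim_w leP charQ QE f0 fQ gcd_f szf un szxs Hxs.
pose X (j : nat) := [seq a <- xs | f.[a] ^+ g == eps ^+ j].
have eps0 j : eps ^+ j != 0 by rewrite expf_neq0 // (prim_root_neq0 prim_eps).
have g0 : (0 < g)%N.
  have : (1 < Q)%N by rewrite /Q (@leq_trans (2 * 2)) // leq_mul //; lia.
  by rewrite QE; case: (g) => //; rewrite muln0.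
have boundX j : (d * size (X j) <= Q + C * P)%N.
  apply: (HC K g P f (eps ^+ j)) => //; first by rewrite (leq_trans _ leP) ?leq_addr.
    exact: filter_uniq.
  move=> a; rewrite mem_filter => /andP[/eqP fa axs]; split=> //; first exact: Hxs.
  by apply/eqP => fa0; move: (eps0 j); rewrite -fa fa0 expr0n gtn_eqF ?eqxx.
have sumE : \sum_(a <- xs) root_char d eps w (f.[a] ^+ g) =
  \sum_(j < d) w ^+ j * (size (X j))%:R.
  rewrite exchange_big; apply: eq_bigr => j _ /=.
  rewrite -mulr_suml mulrC; congr (_ * _).
  rewrite /X size_filter -sum1_count natr_sum [RHS]big_mkcond /=.
  by apply: eq_bigr => a _; case: ifP.
have fgd a : a \in xs -> f.[a] != 0 -> (f.[a] ^+ g) ^+ d = 1.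
  move=> /Hxs aQ fa0; apply: (mulIf fa0); rewrite mul1r -exprM mulnC -exprSr -addn1 -QE.
  by rewrite -horner_exp -fQ horner_comp hornerXn aQ.
have cardX : (Q <= \sum_(j < d) size (X j) + D)%N.
  have : (size xs <= count (predC (root f)) xs + count (root f) xs)%N.
    by rewrite -(count_predC (root f)) addnC.
  move=> h; rewrite -szxs (leq_trans h) // leq_add //.
    rewrite -sum1_count.
    under [leqRHS]eq_bigr do rewrite /X size_filter -sum1_count big_mkcond /=.
    rewrite [leqRHS]exchange_big [leqLHS]big_mkcond /= !big_seq; apply: leq_sum =>
      a axs.
    case: ifP => // fa0; have /(prim_rootP prim_eps)[j fE] := fgd a axs fa0.
    by rewrite (bigD1 j) //= fE eqxx.
  rewrite -size_filter -ltnS (leq_trans _ szf) //; apply: max_poly_roots => //.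
    by apply/allP => a; rewrite mem_filter => /andP[].
  exact: filter_uniq.
rewrite sumE.
(* M bounds every level set from above; subtracting it from all of them does not
   change the sum, since the d-th roots of unity add up to 0. *)
pose M : algC := (Q + C * P)%:R / d%:R.
have dR : 0 < d%:R :> algC by rewrite ltr0n.
have -> : \sum_(j < d) w ^+ j * (size (X j))%:R =
  \sum_(j < d) w ^+ j * ((size (X j))%:R - M).
  under [RHS]eq_bigr do rewrite mulrBr.
  by rewrite sumrB -mulr_suml (sum_prim_root d1 prim_w) mul0r subr0.
apply: (@le_trans _ _ (\sum_(j < d) (M - (size (X j))%:R))).
  rewrite (le_trans (ler_norm_sum _ _ _)) // ler_sum // => j _.
  rewrite normrM normrX (normr_prim_root prim_w) expr1n mul1r ler0_norm ?opprB //.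
  by rewrite subr_le0 /M ler_pdivlMr // -natrM ler_nat mulnC.
rewrite sumrB sumr_const card_ord -natr_sum /M -[_ *+ d]mulr_natr divfK ?gt_eqF //.
rewrite lerBlDr -natrM -natrD ler_nat.
have : (D <= D * P)%N by rewrite leq_pmulr //; lia.
rewrite mulnDl. move: cardX; move: (\sum_(_ < _) _)%N => S; lia.
Qed.

(** * Frobenius orbits of points and of their polynomials *)

Lemma pchar_card_finField (F : finFieldType) : [pchar F].-nat #|F|.
Proof.
have /is_abelemP[p p_pr /abelem_pgroup/p_natP[n]] := finField_is_abelem F.
rewrite cardsT => cardF; have pcharFp := card_finPcharP cardF p_pr.
by rewrite (eq_pnat _ (pcharf_eq pcharFp)) cardF pnatX pnat_id.
Qed.

Section PowerFrobenius.
Variables (K : fieldType) (q : nat).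
Hypothesis charq : [pchar K].-nat q.

(** The proof that q is a power of the characteristic is an argument so that the
    ring morphism structure can be attached to the function. *)
Definition power_frobenius of [pchar K].-nat q := fun x : K => x ^+ q.
Local Notation frob := (power_frobenius charq).

Fact power_frobenius_is_zmod_morphism : zmod_morphism frob.
Proof. by move=> x y; rewrite /power_frobenius exprDn_pchar // exprNn_pchar. Qed.
Fact power_frobenius_is_monoid_morphism : monoid_morphism frob.
Proof. by split=> [|x y]; rewrite /power_frobenius ?expr1n ?exprMn. Qed.

HB.instance Definition _ := GRing.isZmodMorphism.Build K K frob
  power_frobenius_is_zmod_morphism.
HB.instance Definition _ := GRing.isMonoidMorphism.Build K K frob
  power_frobenius_is_monoid_morphism.

Lemma power_inj : injective (fun x : K => x ^+ q).
Proof. exact: (fmorph_inj frob). Qed.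

Lemma iter_power_inj j : injective (fun x : K => x ^+ (q ^ j)).
Proof.
elim: j => [|j IH] x y; first by rewrite expn0 !expr1.
by rewrite expnSr !exprM => /power_inj/IH.
Qed.

End PowerFrobenius.

Lemma fixed_points_enum (K : closedFieldType) (Q : nat) :
  (1 < Q)%N -> [pchar K].-nat Q ->
  {xs : seq K | [/\ uniq xs, size xs = Q & forall x, (x \in xs) = (x ^+ Q == x)]}.
Proof.
move=> Q1 charQ; pose p : {poly K} := 'X^Q - 'X.
have szp : size p = Q.+1.
  by rewrite size_polyDl size_polyXn // size_polyN size_polyX.
have monp : lead_coef p = 1.
  by rewrite lead_coefDl ?lead_coefXn // size_polyXn size_polyN size_polyX.
have [xs pE] := closed_field_poly_normal p.
rewrite monp scale1r in pE.
have Q0 : Q%:R = 0 :> K.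
  have pQ : pdiv Q \in [pchar K] by apply: (pnatPpi charQ); rewrite pi_pdiv.
  by rewrite -(divnK (pdiv_dvd Q)) natrM (pcharf0 pQ) mulr0.
have un : uniq xs.
  rewrite -separable_prod_XsubC -pE unlock.
  have -> : p^`() = -1 by rewrite derivB derivXn derivX -mulr_natl -polyC_natr Q0 mul0r
    sub0r.
  by rewrite -scaleN1r coprimepZr ?oppr_eq0 ?oner_eq0 // coprimep1.
exists xs; split=> //; first by have := size_prod_XsubC xs id; rewrite -pE szp => -[].
move=> x; rewrite -root_prod_XsubC -pE rootE !hornerE subr_eq0.
by [].
Qed.

Lemma sum_multiples delta m n : (0 < delta)%N -> (delta * m <= n)%N ->
  (\sum_(1 <= r < n.+1) ((delta %| r) && (r %/ delta <= m)) = m)%N.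
Proof.
move=> d0 le;
transitivity (count (fun r => (delta %| r) && (r %/ delta <= m))%N (iota 1 n)).
  rewrite -sum1_count [RHS]big_mkcond /index_iota subn1 /=.
  by apply: eq_bigr => r _; case: (_ && _).
rewrite -size_filter.
rewrite -[RHS](size_iota 1) -[RHS](size_map (muln delta)); apply: perm_size.
apply: uniq_perm; first by rewrite filter_uniq ?iota_uniq.
  by rewrite map_inj_uniq ?iota_uniq // => i j /eqP; rewrite eqn_pmul2l // => /eqP.
move=> r; rewrite mem_filter mem_iota; apply/idP/mapP.
  move=> /andP[/andP[/dvdnP[j ->]]]; rewrite mulnK // => jm /andP[r1 _].
  exists j; last exact: mulnC.
  by rewrite mem_iota add1n ltnS jm andbT; case: (j) r1.
case=> j; rewrite mem_iota add1n ltnS => /andP[j1 jm] ->.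
rewrite dvdn_mulr //= mulKn // jm /= muln_gt0 d0 j1 /= add1n ltnS.
by rewrite (leq_trans _ le) // leq_mul2l jm orbT.
Qed.

Section FrobeniusOrbits.
Variables (K : closedFieldType) (q : nat).
Hypotheses (q_gt1 : (1 < q)%N) (charq : [pchar K].-nat q).
Local Notation frob := (power_frobenius charq).

(** For x in the extension of degree r, this is the characteristic polynomial of
    x over the field with q elements. *)
Definition orbit_poly r (x : K) : {poly K} := \prod_(j < r) ('X - (x ^+ (q ^ j))%:P).

Lemma orbit_poly_monic r x : orbit_poly r x \is monic.
Proof. exact: monic_prod_XsubC. Qed.

Lemma size_orbit_poly r x : size (orbit_poly r x) = r.+1.
Proof. 
by rewrite /orbit_poly -(big_mkord xpredT (fun j =>
  'X - (x ^+ (q ^ j))%:P)) size_prod_XsubC size_iota subn0. Qed.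

Lemma power_fixedD r s (x : K) : x ^+ (q ^ r) = x -> x ^+ (q ^ (r + s)) = x ^+ (q ^ s).
Proof. by move=> fx; rewrite expnD exprM fx. Qed.

Lemma frob_orbit_poly r (x : K) : x ^+ (q ^ r) = x ->
  map_poly frob (orbit_poly r x) = orbit_poly r x.
Proof.
case: r => [|r] fx; first by rewrite /orbit_poly big_ord0 rmorph1.
have E j : map_poly frob ('X - (x ^+ (q ^ j))%:P) = 'X - (x ^+ (q ^ j.+1))%:P.
  by rewrite map_polyXsubC /= /power_frobenius -exprM -expnSr.
rewrite rmorph_prod /= big_ord_recr E fx [RHS]big_ord_recl mulrC expn0 expr1;
  congr (_ * _).
by apply: eq_bigr => j _; rewrite E.
Qed.

Lemma orbit_poly_mul delta j (x : K) : x ^+ (q ^ delta) = x ->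
  orbit_poly (delta * j) x = orbit_poly delta x ^+ j.
Proof.
move=> fx; elim: j => [|j IH]; first by rewrite muln0 /orbit_poly big_ord0.
rewrite mulnS exprS -IH /orbit_poly big_split_ord /=; congr (_ * _).
by apply: eq_bigr => i _; rewrite power_fixedD.
Qed.

Lemma frob_root (G : {poly K}) x j : map_poly frob G = G -> root G x ->
  root G (x ^+ (q ^ j)).
Proof.
move=> fG; elim: j => [|j IH] Gx; first by rewrite expr1.
rewrite expnSr exprM -[G]fG rootE.
have -> : x ^+ (q ^ j) ^+ q = frob (x ^+ (q ^ j)) by [].
by rewrite horner_map (rootP (IH Gx)) rmorph0.
Qed.

Lemma frob_mup (G : {poly K}) x j : G != 0 -> map_poly frob G = G ->
  mup (x ^+ (q ^ j)) G = mup x G.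
Proof.
move=> G0 fG; elim: j => [|j IH]; first by rewrite expr1.
by rewrite -IH -[in LHS]fG -(mup_map frob _ G0) /= /power_frobenius -exprM -expnSr.
Qed.

(** If delta is the period of x, then r must be a multiple j delta, and then the
    orbit polynomial is the j-th power of a squarefree polynomial whose roots all
    have the multiplicity of x in G. *)
Lemma orbit_count (G : {poly K}) x n :
    G \is monic -> size G = n.+1 -> map_poly frob G = G -> root G x ->
  (\sum_(1 <= r < n.+1) ((x ^+ (q ^ r) == x)%R && (orbit_poly r x %| G)%R) = mup x G)%N.
Proof.
move=> monG szG fG Gx; have G0 := monic_neq0 monG.
have [delta0 /andP[d0 /eqP dx]] : exists r, (0 < r)%N && (x ^+ (q ^ r) == x).
  pose t := [seq x ^+ (q ^ j) | j <- iota 0 n.+1].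
  have Nun : ~~ uniq t.
    apply/negP => un; have := max_poly_roots G0 _ un.
    rewrite size_map size_iota szG ltnn; move/implyP; rewrite implybF => /negP; apply.
    by apply/allP => _ /mapP[j _ ->]; apply: frob_root.
  have [i [j [ij E]]] : exists i j, (i < j)%N /\ x ^+ (q ^ i) = x ^+ (q ^ j).
    move: Nun; rewrite -[uniq t]negbK; move/negPn/(uniqPn 0) => [i [j [ij]]].
    rewrite size_map size_iota => jn.
    rewrite !(nth_map 0%N) ?size_iota ?(ltn_trans ij) // !nth_iota ?(ltn_trans ij) //
      !add0n => E.
    by exists i, j.
  exists (j - i)%N; rewrite subn_gt0 ij /=; apply/eqP.
  apply: (iter_power_inj charq (j := i)); rewrite -exprM -expnD subnK ?(ltnW ij) //.
have ex : exists r, (0 < r)%N && (x ^+ (q ^ r) == x) by exists delta0;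
  rewrite d0 dx eqxx.
case: (ex_minnP ex) => delta /andP[delta_gt0 /eqP xdelta] min_delta {delta0 d0 dx ex}.
have xmul j : x ^+ (q ^ (delta * j)) = x.
  by elim: j => [|j IH]; rewrite ?muln0 ?expr1 // mulnS power_fixedD.
have fixedE r : (x ^+ (q ^ r) == x) = (delta %| r)%N.
  apply/eqP/idP => [fx|/dvdnP[j ->]]; last by rewrite mulnC.
  have [mod0|mod_gt0] := posnP (r %% delta)%N; first exact/eqP.
  have /min_delta : (0 < r %% delta)%N && (x ^+ (q ^ (r %% delta)) == x).
    by rewrite mod_gt0 -(power_fixedD _ (xmul (r %/ delta)%N)) mulnC -divn_eq fx eqxx.
  by rewrite leqNgt ltn_pmod.
have dvdE j : (orbit_poly delta x ^+ j %| G) = (j <= mup x G)%N.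
  pose xs := [seq x ^+ (q ^ i) | i <- iota 0 delta].
  have uniq_xs : uniq xs.
    rewrite map_inj_in_uniq ?iota_uniq // => i k; rewrite !mem_iota !add0n /= =>
      ltid ltkd.
    wlog le_ik : i k ltid ltkd / (i <= k)%N.
      by move=> H E; case/orP: (leq_total i k) => le; [apply: H | apply/esym/H].
    move=> E; apply/eqP; rewrite eqn_leq le_ik /= -subn_eq0 -leqn0 leqNgt;
      apply/negP => lt0.
    have /min_delta : (0 < k - i)%N && (x ^+ (q ^ (k - i)) == x).
      rewrite lt0; apply/eqP; apply: (iter_power_inj charq (j := i)).
      by rewrite -exprM -expnD subnK.
    by rewrite leqNgt (leq_ltn_trans (leq_subr _ _)).
  have PE : orbit_poly delta x ^+ j = \prod_(a <- xs) ('X - a%:P) ^+ j.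
    by rewrite /orbit_poly -prodrXl big_map -(big_mkord xpredT (fun i =>
      ('X - (x ^+ (q ^ i))%:P) ^+ j)) /index_iota subn0.
  apply/idP/idP => [|le_j]; last first.
    rewrite PE; apply: dvdp_prod_XsubC_exp => // a /mapP[i _ ->].
    by rewrite -(mup_geq _ _ G0) (frob_mup _ _ G0 fG).
  rewrite mup_geq //; apply: dvdp_trans; rewrite PE.
  have xxs : x \in xs by apply/mapP; exists 0%N; rewrite ?mem_iota ?expr1.
  by rewrite (big_rem _ xxs) /= dvdp_mulr.
have le_n : (delta * mup x G <= n)%N.
  have := dvdE (mup x G); rewrite leqnn => /(dvdp_leq G0).
  by rewrite -orbit_poly_mul // size_orbit_poly szG ltnS.
rewrite -[RHS](sum_multiples delta_gt0 le_n); apply: eq_bigr => r _.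
rewrite fixedE; case: (boolP (delta %| r)%N) => //= /dvdnP[j ->].
by rewrite mulnK // mulnC orbit_poly_mul // dvdE.
Qed.

(** Each root of G, counted with multiplicity, is accounted for once: a root x of
    Frobenius period delta and multiplicity m contributes the m values
    r = delta, 2 delta, ..., m delta. *)
Lemma sum_orbit_count (G : {poly K}) n (E : nat -> seq K) :
    G \is monic -> size G = n.+1 -> map_poly frob G = G ->
    (forall r, (0 < r)%N -> uniq (E r) /\ forall x, (x \in E r) =
      (x ^+ (q ^ r) == x)) ->
  (\sum_(1 <= r < n.+1) \sum_(x <- E r) (orbit_poly r x %| G)%R = n)%N.
Proof.
move=> monG szG fG HE.
have [s GE] := closed_field_poly_normal G.
rewrite (monicP monG) scale1r in GE.
have szs : size s = n by have := size_prod_XsubC s id; rewrite -GE szG => -[].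
transitivity (\sum_(1 <= r < n.+1) \sum_(x <- undup s) ((x ^+ (q ^ r) == x)%R &&
  (orbit_poly r x %| G)%R))%N.
  rewrite !big_nat; apply: eq_bigr => r /andP[r1 _]; have [unE memE] := HE r r1.
  rewrite (bigID (mem s)) /= [X in (_ + X)%N]big1 ?addn0; last first.
    move=> x xNs; case: (boolP (_ %| _)) => // dv.
    case/negP: xNs; rewrite -root_prod_XsubC -GE -dvdp_XsubCl.
    apply: dvdp_trans dv; rewrite /orbit_poly; case: (r) r1 => // r' _.
    by rewrite big_ord_recl expr1 dvdp_mulr.
  under [RHS]eq_bigr do rewrite -mulnb.
  rewrite [RHS](eq_bigr (fun x => if x ^+ (q ^ r) == x then (orbit_poly r x %| G)%R :
    nat else 0%N)); last first.
    by move=> x _; case: ifP; rewrite ?mul1n ?mul0n.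
  rewrite -big_mkcond /= -[LHS]big_filter -[RHS]big_filter.
  apply: perm_big; apply: uniq_perm; rewrite ?filter_uniq ?undup_uniq //.
  by move=> x; rewrite !mem_filter memE mem_undup andbC.
rewrite exchange_big /= -[RHS]szs -[RHS]sum1_size -[RHS]big_undup_iterop_count.
rewrite [LHS]big_seq [RHS]big_seq; apply: eq_bigr => x; rewrite mem_undup => xs.
rewrite orbit_count //; last by rewrite GE root_prod_XsubC.
by rewrite GE mu_prod_XsubC Monoid.iteropE iter_addn_0 mul1n.
Qed.
End FrobeniusOrbits.

(** * The L-function of a product of power residue characters *)

Section Monics.
Variable F : finFieldType.

(** Monic polynomials are listed through their lower coefficients, so that sums
    over those of a given degree are finite sums. *)
Definition monics n : seq {poly F} := [seq 'X^n + rVpoly v | v : 'rV[F]_n].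

Lemma mem_monics n g : (g \in monics n) = (g \is monic) && (size g == n.+1).
Proof.
apply/imageP/andP => [[v _ ->]|[/monicP lg /eqP sg]].
  have lt : (size (rVpoly v) < size ('X^n : {poly F}))%N.
    by rewrite size_polyXn ltnS size_poly.
  by rewrite monicE lead_coefDl // lead_coefXn eqxx size_polyDl // size_polyXn.
exists (poly_rV (g - 'X^n)); rewrite // poly_rV_K ?subrKC ?[_ + (_ - _)]addrC ?subrK //.
apply/leq_sizeP => j; rewrite leq_eqVlt coefB coefXn => /orP[/eqP<-|ltnj].
  by rewrite eqxx; move: lg; rewrite lead_coefE sg /= => ->; rewrite subrr.
by rewrite nth_default ?sg // gtn_eqF // subrr.
Qed.

Lemma uniq_monics n : uniq (monics n).
Proof. by apply/dinjectiveP => u v _ _ /addrI/(can_inj rVpolyK). Qed.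

Lemma monics0 : monics 0 = [:: 1].
Proof.
apply: perm_small_eq => //; apply: uniq_perm; rewrite ?uniq_monics // => g.
rewrite mem_monics inE; apply/andP/eqP => [[/monicP lg /eqP sg]|->];
  last by rewrite monic1 size_poly1.
move: lg; rewrite lead_coefE sg /= => lg.
by rewrite (size1_polyC (eq_leq sg)) lg.
Qed.

Lemma perm_monics_shift n (p : {poly F}) : (size p <= n)%N ->
  perm_eq [seq g + p | g <- monics n] (monics n).
Proof.
move=> szp; apply: uniq_perm; rewrite ?uniq_monics //.
  by rewrite map_inj_uniq ?uniq_monics // => g g' /addIr.
have shift (p' : {poly F}) g : (size p' <= n)%N -> g \in monics n ->
  g + p' \in monics n.
  rewrite !mem_monics => szp' /andP[/monicP lg /eqP sg].
  have lt : (size p' < size g)%N by rewrite sg ltnS.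
  by rewrite monicE lead_coefDl // lg eqxx size_polyDl // sg eqxx.
move=> g; apply/mapP/idP => [[g' g'n ->]|gn]; first exact: shift.
by exists (g - p); rewrite ?subrK // shift ?size_polyN.
Qed.

Lemma perm_monics_dvd r m (p : {poly F}) : p \is monic -> size p = r.+1 ->
  perm_eq [seq p * g | g <- monics m] [seq g <- monics (r + m) | p %| g].
Proof.
move=> monp szp; have p0 := monic_neq0 monp.
apply: uniq_perm; rewrite ?filter_uniq ?uniq_monics //.
  by rewrite map_inj_uniq ?uniq_monics // => g g' /(mulfI p0).
move=> g; rewrite mem_filter mem_monics; apply/mapP/andP.
  case=> g'; rewrite mem_monics => /andP[mong' /eqP szg'] ->.
  rewrite dvdp_mulr // monicMl // mong' size_mul ?monic_neq0 // szp szg'.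
  by split=> //; apply/eqP; lia.
case=> /dvdpP[g' ->]; rewrite monicMr // => /andP[mong' /eqP szg].
exists g'; last exact: mulrC.
move: szg; rewrite size_mul ?monic_neq0 // szp mem_monics mong' addnS /= => szg.
by rewrite -(eqn_add2r r) szg addSn addnC.
Qed.

End Monics.

Lemma finField_primitive_element (F : finFieldType) :
  exists z : F, (#|F|.-1).-primitive_root z.
Proof.
have q1 := finNzRing_gt1 F.
pose rs := [seq x <- enum F | x != 0].
suff /hasP[z _ prim_z] : has (#|F|.-1).-primitive_root rs by exists z.
apply: has_prim_root; first by rewrite -subn1 subn_gt0.
- apply/allP => x; rewrite mem_filter => /andP[x0 _].
  apply/unity_rootP; apply: (mulIf x0).
  by rewrite mul1r -exprSr prednK ?expf_card // ltnW.
- exact/filter_uniq/enum_uniq.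
have := count_predC (pred1 (0 : F)) (enum F).
rewrite (@count_uniq_mem _ (enum F)) ?enum_uniq // mem_enum -cardE add1n => <-.
by rewrite size_filter.
Qed.

Lemma finField_prim_root (F : finFieldType) d e : (0 < d)%N ->
  #|F| = (d * e + 1)%N -> exists eps : F, d.-primitive_root eps.
Proof.
move=> d0 cardF; have [z] := finField_primitive_element F; rewrite cardF addn1 /= =>
  prim_z.
have := prim_order_gt0 prim_z; rewrite muln_gt0 => /andP[_ e0].
by exists (z ^+ e); have := exp_prim_root prim_z e;
  rewrite (gcdn_idPl _) ?dvdn_mull // mulnK.
Qed.

Lemma power_residue_surj (F : finFieldType) d e (eps : F) :
  #|F| = (d * e + 1)%N -> d.-primitive_root eps -> exists s : F, s ^+ e = eps.
Proof.
move=> cardF prim_eps; have [z] := finField_primitive_element F;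
  rewrite cardF addn1 /= => prim_z.
have := prim_order_gt0 prim_z; rewrite muln_gt0 => /andP[_ e0].
have prim_ze := exp_prim_root prim_z e.
rewrite (gcdn_idPl _) ?dvdn_mull // mulnK // in prim_ze.
have /(prim_rootP prim_ze)[k ->] := prim_expr_order prim_eps.
by exists (z ^+ k); rewrite -!exprM mulnC.
Qed.

Lemma root_char_map (F K : fieldType) (phi : {rmorphism F -> K}) d eps w z :
  root_char d (phi eps) w (phi z) = root_char d eps w z.
Proof.
by apply: eq_bigr => j _; rewrite -rmorphXn (inj_eq (fmorph_inj phi)).
Qed.

Section ResidueCharacter.
Variables (F : finFieldType) (d e : nat) (eps : F) (w : algC).
Hypotheses (cardF : #|F| = (d * e + 1)%N).
Hypotheses (prim_eps : d.-primitive_root eps) (prim_w : d.-primitive_root w).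

Definition residue_char (z : F) : algC := root_char d eps w (z ^+ e).
Local Notation chi := residue_char.

Let d_gt0 : (0 < d)%N := prim_order_gt0 prim_eps.

Lemma residue_exponent_gt0 : (0 < e)%N.
Proof.
rewrite lt0n; apply/eqP => e0; have := finNzRing_gt1 F.
by rewrite cardF e0 muln0.
Qed.

Lemma residue_unity (z : F) : (z ^+ e == 0) || ((z ^+ e) ^+ d == 1).
Proof.
have [->|z0] := eqVneq z 0; first by rewrite expr0n gtn_eqF ?residue_exponent_gt0 ?eqxx.
apply/orP; right; apply/eqP/(mulIf z0); rewrite mul1r -exprM mulnC -exprSr -addn1
  -cardF.
exact: expf_card.
Qed.

Lemma residue_charM : {morph chi : x y / x * y}.
Proof. by move=> x y; rewrite /residue_char exprMn (root_charM prim_eps prim_w)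
  ?residue_unity. Qed.

Lemma residue_char1 : chi 1 = 1.
Proof. by rewrite /residue_char expr1n (root_char1 prim_eps prim_w). Qed.

Lemma residue_char0 : chi 0 = 0.
Proof. by rewrite /residue_char expr0n gtn_eqF ?residue_exponent_gt0 // root_char0. Qed.

Lemma residue_charX z n : chi (z ^+ n) = chi z ^+ n.
Proof. by elim: n => [|n IH]; rewrite ?residue_char1 // !exprS residue_charM IH. Qed.

Lemma residue_char_prod I (r : seq I) (P : pred I) (G : I -> F) :
  chi (\prod_(i <- r | P i) G i) = \prod_(i <- r | P i) chi (G i).
Proof. by apply: (big_morph chi residue_charM residue_char1). Qed.

(** Multiplying the argument by an s with chi s = w leaves the sum unchanged and
    multiplies it by w ^ a, which is not 1. *)
Lemma sum_residue_charX a : ~~ (d %| a)%N -> \sum_z chi z ^+ a = 0.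
Proof.
move=> da; have [s sE] := power_residue_surj cardF prim_eps.
have chis : chi s = w by rewrite /residue_char sE; have :=
  root_charX prim_eps prim_w 1; rewrite !expr1.
have s0 : s != 0.
  apply/eqP => s0; move: chis; rewrite s0 residue_char0 => /esym/eqP.
  by rewrite (negPf (prim_root_neq0 prim_w)).
have E : \sum_z chi z ^+ a = w ^+ a * \sum_z chi z ^+ a.
  rewrite {1}(reindex (fun z => s * z)) /=; last first.
    by exists (fun z => s^-1 * z) => z _; rewrite ?mulKf ?mulVKf.
  by rewrite mulr_sumr; apply: eq_bigr => z _; rewrite residue_charM exprMn chis.
move/eqP: E; rewrite -subr_eq0 -{1}[X in X - _]mul1r -mulrBl mulf_eq0.
by rewrite subr_eq0 eq_sym -(prim_order_dvd prim_w) (negPf da) => /eqP.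
Qed.

End ResidueCharacter.

Section LFunction.
Variables (F : finFieldType) (d e : nat) (eps : F) (w : algC).
Hypotheses (cardF : #|F| = (d * e + 1)%N).
Hypotheses (prim_eps : d.-primitive_root eps) (prim_w : d.-primitive_root w).
Local Notation chi := (residue_char d e eps w).
Local Notation q := #|F|.
Variable us : seq (F * nat).

(** The pairs (c, a) of us encode the points c with the exponents a of the
    characters attached to them. *)
Definition poly_weight (g : {poly F}) : F := \prod_(u <- us) g.[u.1] ^+ u.2.
Definition poly_char g : algC := chi (poly_weight g).
Definition L_coef n : algC := \sum_(g <- monics F n) poly_char g.

Lemma poly_charM g g' : poly_char (g * g') = poly_char g * poly_char g'.
Proof.
rewrite -(residue_charM cardF prim_eps prim_w) -big_split /=; congr chi.
by apply: eq_bigr => u _; rewrite hornerM exprMn.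
Qed.

Lemma L_coef0 : L_coef 0 = 1.
Proof.
rewrite /L_coef monics0 big_seq1 /poly_char /poly_weight big1 => [|u _].
  exact: residue_char1.
by rewrite hornerC expr1n.
Qed.

(** In degree n at least the number of points, some p of degree less than n is
    nonzero at one point of nontrivial character and zero at the others.
    Translating g by the multiples of p averages that character to zero. *)
Lemma L_coef_eq0 n : uniq [seq u.1 | u <- us] -> (exists2 u, u \in us & ~~ (d %|
  u.2)%N) ->
  (size us <= n)%N -> L_coef n = 0.
Proof.
move=> un [u uus du] szn.
pose rest := rem u us; have perm_us : perm_eq us (u :: rest) := perm_to_rem uus.
have /= /andP[uNrest _] : uniq [seq v.1 | v <- u :: rest].
  by rewrite -(perm_uniq (perm_map _ perm_us)).
pose p : {poly F} := \prod_(c <- [seq v.1 | v <- rest]) ('X - c%:P).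
have szp : (size p <= n)%N.
  by rewrite size_prod_XsubC size_map (leq_trans _ szn) // (perm_size perm_us).
have pu : p.[u.1] != 0 by rewrite -[_ == 0]/(root _ _) root_prod_XsubC.
have pv v : v \in rest -> p.[v.1] = 0.
  by move=> vr; apply/eqP; rewrite -[_ == 0]/(root _ _) root_prod_XsubC map_f.
have charE g t : poly_char (g + t *: p)
   = chi (g.[u.1] + t * p.[u.1]) ^+ u.2 * chi (\prod_(v <- rest) g.[v.1] ^+ v.2).
  rewrite /poly_char /poly_weight (perm_big _ perm_us) big_cons /=.
  rewrite (residue_charM cardF prim_eps prim_w) (residue_charX cardF prim_eps prim_w).
  rewrite hornerD hornerZ; congr (_ * chi _).
  by rewrite !big_seq; apply: eq_bigr => v vr; rewrite hornerD hornerZ pv // mulr0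
    addr0.
have q0 : q%:R != 0 :> algC by rewrite pnatr_eq0 -lt0n ltnW // finNzRing_gt1.
apply: (mulfI q0); rewrite mulr0 mulr_natl -sumr_const.
rewrite (eq_bigr (fun t => \sum_(g <- monics F n) poly_char (g + t *: p))); last first.
  move=> t _; rewrite /L_coef -(perm_big _ (perm_monics_shift (n := n) (p :=
    t *: p) _)) ?big_map //.
  exact: leq_trans (size_scale_leq _ _) szp.
rewrite exchange_big big1 // => g _.
under eq_bigr do rewrite charE.
rewrite -mulr_suml (_ : \sum_t _ = 0) ?mul0r //.
rewrite -[RHS](sum_residue_charX cardF prim_eps prim_w du) [RHS](reindex (fun t =>
  g.[u.1] + t * p.[u.1])) //.
exists (fun z => (z - g.[u.1]) / p.[u.1]) => z _; first by rewrite addrC addKr mulfK.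
by rewrite divfK // addrC subrK.
Qed.

(** The exponent (q^r - 1) / d, as the product of e with the exponent of the norm
    from the extension of degree r. *)
Definition ext_exponent r := (e * \sum_(j < r) q ^ j)%N.

Lemma ext_exponentE r : (q ^ r = d * ext_exponent r + 1)%N.
Proof.
rewrite /ext_exponent mulnA; elim: r => [|r IH]; first by rewrite big_ord0 muln0.
rewrite big_ord_recr /= mulnDr addnAC -IH expnS; move: (q ^ r)%N => Q.
by rewrite cardF mulnDl mul1n addnC.
Qed.

Section Extension.
Variables (K : closedFieldType) (phi : {rmorphism F -> K}).

Lemma pchar_extension : [pchar K].-nat q.
Proof. by rewrite (eq_pnat _ (fmorph_pchar phi)) pchar_card_finField. Qed.
Let charq := pchar_extension.
Local Notation frob := (power_frobenius charq).

Lemma extension_fixed (z : K) : z ^+ q = z -> exists x, phi x = z.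
Proof.
move=> fz; have : root (map_poly phi ('X^q - 'X)) z.
  by rewrite rmorphB /= map_polyXn map_polyX rootE !hornerE fz subrr.
rewrite finField_genPoly rmorph_prod /=.
under eq_bigr do rewrite map_polyXsubC.
rewrite -(big_map phi xpredT (fun c => 'X - c%:P)) root_prod_XsubC.
by case/mapP => x _ ->; exists x.
Qed.

Lemma frob_extension (x : F) : frob (phi x) = phi x.
Proof. by rewrite /power_frobenius -rmorphXn expf_card. Qed.

Lemma frob_map_extension (g : {poly F}) : map_poly frob (map_poly phi g) =
  map_poly phi g.
Proof. by rewrite -map_poly_comp; apply: eq_map_poly => x; apply: frob_extension. Qed.

Definition descend (G : {poly K}) : {poly F} :=
  \poly_(i < size G) odflt 0 [pick x | phi x == G`_i].

Lemma descendK G : map_poly frob G = G -> map_poly phi (descend G) = G.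
Proof.
move=> fG; apply/polyP => i; rewrite coef_map coef_poly.
case: ltnP => [_|le] /=; last by rewrite rmorph0 nth_default.
have [x xE] : exists x, phi x = G`_i.
  by apply: extension_fixed; rewrite -[in RHS]fG coef_map.
case: pickP => [y /eqP //|/(_ x)]; by rewrite xE eqxx.
Qed.

Definition ext_poly : {poly K} := \prod_(u <- us) ((phi u.1)%:P - 'X) ^+ u.2.

(** With xs the list of elements of the extension of degree r, this is the sum of
    the characters composed with the norm. *)
Definition ext_sum r (xs : seq K) : algC :=
  \sum_(x <- xs) root_char d (phi eps) w (ext_poly.[x] ^+ ext_exponent r).

Lemma ext_polyE x : ext_poly.[x] = \prod_(u <- us) (phi u.1 - x) ^+ u.2.
Proof. by rewrite horner_prod; apply: eq_bigr => u _; rewrite !hornerE. Qed.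

Lemma ext_poly_frob x j : ext_poly.[x ^+ (q ^ j)] = ext_poly.[x] ^+ (q ^ j).
Proof.
elim: j => [|j IH]; first by rewrite !expr1.
rewrite expnSr !exprM -IH; move: (x ^+ _) => y.
rewrite !ext_polyE -[RHS]/(frob _) rmorph_prod; apply: eq_bigr => u _.
by rewrite rmorphXn rmorphB /= frob_extension.
Qed.

(** The value of the orbit polynomial of x at a point c is the norm of c - x. *)
Lemma poly_char_orbit r x : x ^+ (q ^ r) = x ->
  poly_char (descend (orbit_poly q r x)) = root_char d (phi eps) w (ext_poly.[x] ^+
    ext_exponent r).
Proof.
move=> fx; rewrite /poly_char /residue_char -(root_char_map phi) rmorphXn /=;
  congr root_char.
rewrite /poly_weight rmorph_prod /= /ext_exponent mulnC exprM; congr (_ ^+ _).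
rewrite expr_sum; under [RHS]eq_bigr do rewrite -ext_poly_frob ext_polyE.
rewrite [RHS]exchange_big /=; apply: eq_bigr => u _.
rewrite rmorphXn -horner_map /= descendK ?(frob_orbit_poly charq) //.
rewrite horner_prod -prodrXl.
by apply: eq_bigr => j _; rewrite !hornerE.
Qed.

(** Expanding the right-hand side, S_r A_(n-r) counts the monic g of degree n,
    weighted by chi(g), together with an x whose orbit polynomial of length r
    divides g.  By [sum_orbit_count] each g occurs n times in total. *)
Lemma newton_L_coef (E : nat -> seq K) n :
  (forall r, (0 < r)%N -> uniq (E r) /\ forall x, (x \in E r) = (x ^+ (q ^ r) == x)) ->
  n%:R * L_coef n = \sum_(1 <= r < n.+1) ext_sum r (E r) * L_coef (n - r).
Proof.
move=> HE.
transitivity (\sum_(1 <= r < n.+1) \sum_(x <- E r) \sum_(g <- monics F n)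
    (orbit_poly q r x %| map_poly phi g)%R%:R * poly_char g); last first.
  rewrite !big_nat; apply: eq_bigr => r /andP[r1 rn].
  have [_ memE] := HE r r1.
  rewrite /ext_sum mulr_suml !big_seq; apply: eq_bigr => x; rewrite memE => /eqP fx.
  have fP := frob_orbit_poly charq fx.
  rewrite -(poly_char_orbit fx) /L_coef mulr_sumr.
  under [RHS]eq_bigr do rewrite -poly_charM.
  have monP : descend (orbit_poly q r x) \is monic.
    by rewrite -(map_monic phi) descendK // orbit_poly_monic.
  have szP : size (descend (orbit_poly q r x)) = r.+1.
    by rewrite -(size_map_poly phi) descendK // size_orbit_poly.
  rewrite -(big_map (fun g => descend (orbit_poly q r x) * g) xpredT poly_char).
  rewrite (perm_big _ (perm_monics_dvd (n - r) monP szP)) subnKC //.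
  rewrite big_filter [RHS]big_mkcond; apply: eq_bigr => g _.
  by rewrite -(dvdp_map phi) descendK //; case: ifP; rewrite ?mul1r ?mul0r.
under eq_bigr do rewrite exchange_big /=.
rewrite exchange_big mulr_sumr /= !big_seq; apply: eq_bigr => g.
rewrite mem_monics => /andP[mong /eqP szg].
under eq_bigr do rewrite -mulr_suml.
rewrite -mulr_suml; congr (_ * _).
rewrite -[in LHS](@sum_orbit_count K q charq (map_poly phi g) n E) //.
- rewrite natr_sum; apply: eq_bigr => r _; by rewrite natr_sum.
- by rewrite map_monic.
- by rewrite size_map_poly.
- exact: frob_map_extension.
Qed.

End Extension.
End LFunction.

(** * The Weil bound *)

Lemma inverse_roots (C : closedFieldType) (L : {poly C}) : L`_0 = 1 ->
  exists ws : seq C, (size ws).+1 = size L /\ L = \prod_(w <- ws) (1 - w *: 'X).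
Proof.
move=> L0; have [rs LE] := closed_field_poly_normal L.
have Lnz : L != 0 by apply/eqP => Lz; move: L0; rewrite Lz coef0 => /esym/eqP;
  rewrite oner_eq0.
have rs0 z : z \in rs -> z != 0.
  move=> zrs; apply/eqP => z0; have : root L z.
    by rewrite LE rootZ ?lead_coef_eq0 // root_prod_XsubC.
  by rewrite rootE z0 horner_coef0 L0 oner_eq0.
have prodE : \prod_(z <- rs) ('X - z%:P) = (\prod_(z <- rs) (- z)) *: \prod_(z <- rs)
  (1 - z^-1 *: 'X).
  rewrite -mul_polyC rmorph_prod -big_split /= !big_seq; apply: eq_bigr => z zrs.
  by rewrite mulrBr mulr1 mul_polyC scalerA mulNr mulfV ?rs0 // scaleN1r opprK polyCN
    addrC.
exists [seq z^-1 | z <- rs]; split.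
  by rewrite size_map LE size_scale ?lead_coef_eq0 // size_prod_XsubC.
rewrite big_map {1}LE prodE scalerA; set c := _ * _.
suff -> : c = 1 by rewrite scale1r.
move: L0; rewrite -horner_coef0 LE prodE scalerA -/c hornerZ horner_prod.
by rewrite big1 ?mulr1 // => z _; rewrite !hornerE subr0.
Qed.

(** Newton's identities determine the power sums recursively, since the term
    r = n has the coefficient a 0 = 1. *)
Lemma power_sums_of_newton (A : comNzRingType) (a S p : nat -> A) : a 0%N = 1 ->
    (forall n, n%:R * a n = \sum_(1 <= r < n.+1) S r * a (n - r)%N) ->
    (forall n, n%:R * a n = - \sum_(1 <= r < n.+1) p r * a (n - r)%N) ->
  forall r, (0 < r)%N -> S r = - p r.
Proof.
move=> a0 HS Hp; elim/ltn_ind => -[//|n] IH _.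
have := HS n.+1; rewrite Hp big_nat_recr //= [in RHS]big_nat_recr //= subnn a0 !mulr1
  opprD.
rewrite -sumrN [in RHS]big_nat [in LHS]big_nat.
rewrite (eq_bigr (fun r => S r * a (n.+1 - r)%N)); first by move/addrI.
by move=> r /andP[r0 rn]; rewrite IH // mulNr.
Qed.

Section WeilBound.
Variables (F : finFieldType) (d e : nat) (eps : F) (w : algC).
Hypotheses (cardF : #|F| = (d * e + 1)%N).
Hypotheses (prim_eps : d.-primitive_root eps) (prim_w : d.-primitive_root w).
Local Notation chi := (residue_char d e eps w).
Local Notation q := #|F|.
Variable us : seq (F * nat).
Hypotheses (uniq_us : uniq [seq u.1 | u <- us]) (d_gt1 : (1 < d)%N).
Hypothesis gcd_us : forall s, (forall u, u \in us -> d %| s * u.2)%N -> (d %| s)%N.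

Section ExtPoly.
Variables (K : closedFieldType) (phi : {rmorphism F -> K}).
Local Notation f := (ext_poly us phi).

Lemma ext_factor_neq0 (c : K) : c%:P - 'X != 0.
Proof. by rewrite -opprB oppr_eq0 polyXsubC_eq0. Qed.

Lemma ext_poly_neq0 : f != 0.
Proof. by rewrite /ext_poly prodf_seq_neq0; apply/allP => u _ /=;
  rewrite expf_neq0 // ext_factor_neq0. Qed.

Lemma size_ext_poly : (size f <= (\sum_(u <- us) u.2).+1)%N.
Proof.
rewrite /ext_poly; elim/big_rec2: _ => [|u n p _ IH]; first by rewrite size_poly1.
rewrite (leq_trans (size_polyMleq _ _)) //.
have := size_poly_exp_leq ((phi u.1)%:P - 'X) u.2.
rewrite -opprB size_polyN size_XsubC mul1n.
by move: IH; move: (size _) (size _) => a b; lia.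
Qed.

Lemma ext_poly_comp r : f \Po 'X^(q ^ r) = f ^+ (q ^ r).
Proof.
have charq : [pchar {poly K}].-nat (q ^ r)%N.
  by rewrite (eq_pnat _ (pchar_poly K)) pnatX (pchar_extension phi).
rewrite /ext_poly rmorph_prod /= -prodrXl; apply: eq_bigr => u _.
rewrite rmorphXn rmorphB /= comp_polyC comp_polyX exprAC; congr (_ ^+ _).
rewrite exprDn_pchar // exprNn_pchar // -polyC_exp -rmorphXn; congr (_%:P - _).
by congr (phi _); elim: r {charq} => [|r IH]; rewrite ?expr1 // expnS exprM expf_card.
Qed.

Lemma mup_ext_poly u : u \in us -> mup (phi u.1) f = u.2.
Proof.
move=> uus; pose rest := rem u us; have perm_us : perm_eq us (u :: rest) :=
  perm_to_rem uus.
have /= /andP[uNrest _] : uniq [seq v.1 | v <- u :: rest].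
  by rewrite -(perm_uniq (perm_map _ perm_us)).
rewrite /ext_poly (perm_big _ perm_us) big_cons /= mupMl.
  rewrite -opprB exprNn mupMr ?mup_XsubCX ?eqxx //.
  by rewrite -signr_odd; case: (odd _); rewrite ?expr0 ?expr1 rootE !hornerE ?oppr_eq0
    oner_eq0.
rewrite rootE horner_prod prodf_seq_neq0; apply/allP => v vr /=.
rewrite !hornerE expf_eq0 negb_and subr_eq0 (inj_eq (fmorph_inj phi)).
by apply/orP; right; apply: contra uNrest => /eqP <-; apply: map_f.
Qed.

Lemma gcd_ext_poly s : (forall c, (d %| s * mup c f)%N) -> (d %| s)%N.
Proof. by move=> H; apply: gcd_us => u uus; rewrite -(mup_ext_poly uus). Qed.

End ExtPoly.

(** The case where the exponents and d have no common divisor, which the linear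
    independence in Stepanov's method requires. *)
Theorem weil_bound_primitive :
  `|\sum_x \prod_(u <- us) chi (u.1 - x) ^+ u.2| <= (size us).-1%:R * sqrtC q%:R.
Proof.
have q_gt1 : (1 < q)%N := finNzRing_gt1 F.
have [K [phi _]] := countable_algebraic_closure F.
have charq := pchar_extension phi.
have qr_gt1 r : (1 < q ^ r.+1)%N by rewrite -(exp1n r.+1) ltn_exp2r.
have charqr r : [pchar K].-nat (q ^ r)%N by rewrite pnatX charq.
pose E r := if r is r'.+1 then sval (fixed_points_enum (qr_gt1 r') (charqr r'.+1)) else
  [::].
have HE r : (0 < r)%N -> [/\ uniq (E r), size (E r) =
  (q ^ r)%N & forall x, (x \in E r) = (x ^+ (q ^ r) == x)].
  by case: r => // r _; rewrite /E; case: (fixed_points_enum _ _).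
have HE' r : (0 < r)%N -> uniq (E r) /\ forall x, (x \in E r) = (x ^+ (q ^ r) == x).
  by move=> /HE[].
have [u0 u0us du0] : exists2 u, u \in us & ~~ (d %| u.2)%N.
  apply/hasP; apply/negPn; rewrite -all_predC; apply/negP => /allP H.
  have /gcd_us : forall u, u \in us -> (d %| 1 * u.2)%N.
    by move=> u /H /=; rewrite negbK mul1n.
  by rewrite dvdn1 gtn_eqF.
have us_gt0 : (0 < size us)%N by case: (us) u0us.
pose a := L_coef d e eps w us.
pose L := \poly_(n < size us) a n.
have coefL n : L`_n = a n.
  rewrite coef_poly; case: ltnP => // le.
  by rewrite /a (L_coef_eq0 cardF prim_eps prim_w) //; exists u0.
have a0 : a 0%N = 1 by apply: L_coef0.
have [ws [szws LE]] : exists ws : seq algC, (size ws).+1 = size L /\ L =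
  \prod_(z <- ws) (1 - z *: 'X).
  by apply: inverse_roots; rewrite coefL.
pose S r := ext_sum d e eps w us phi r (E r).
pose p r := \sum_(z <- ws) z ^+ r.
have SE : forall r, (0 < r)%N -> S r = - p r.
  apply: (power_sums_of_newton a0) => n.
    exact: (newton_L_coef cardF prim_eps prim_w us phi n HE').
  have /= := newton_identity ws n; rewrite -LE coefL => ->; congr (- _).
  by apply: eq_bigr => r _; rewrite coefL.
have [C [P0 HC]] := extension_sum_bound (\sum_(u <- us) u.2) d_gt1.
have bound N : (P0 < N)%N -> `|\sum_(z <- [seq z ^+ 2 | z <- ws]) z ^+ N| <= C%:R *
  q%:R ^+ N.
  move=> ltN; have N0 : (0 < N)%N by case: (N) ltN.
  have QE : (q ^ N * q ^ N = q ^ (N + N))%N by rewrite expnD.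
  have [unE szE memE] := HE (N + N)%N (ltn_addr _ N0).
  have := HC K (phi eps) w (ext_exponent F e (N + N)) (q ^ N)%N (ext_poly us phi) (E (N
    + N)%N).
  rewrite /= QE => /(_ _ prim_w _ (charqr _) (ext_exponentE cardF _) (ext_poly_neq0 _)
    (ext_poly_comp _ _) (@gcd_ext_poly _ _) (size_ext_poly _) unE szE).
  rewrite fmorph_primitive_root => /(_ prim_eps); rewrite natrX => HC'.
  have -> : \sum_(z <- [seq z ^+ 2 | z <- ws]) z ^+ N = - S (N + N)%N.
    rewrite SE ?ltn_addr // opprK big_map; apply: eq_bigr => z _.
    by rewrite -exprM mul2n addnn.
  rewrite normrN; apply: HC'.
    by rewrite ltnW // (ltn_trans ltN) // ltn_expl.
  by move=> x; rewrite memE => /eqP.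
(* Only extensions of even degree were estimated, hence the squares. *)
have ws_bound z : z \in ws -> `|z| <= sqrtC q%:R.
  move=> zws; have := power_sum_dominance _ bound.
  have z2 : z ^+ 2 \in [seq z ^+ 2 | z <- ws] by apply: (map_f (fun z => z ^+ 2)).
  rewrite ltr0n ltnW // => /(_ isT _ z2).
  rewrite normrX -{1}[q%:R]sqrtCK ler_pXn2r ?nnegrE ?normr_ge0 ?sqrtC_ge0 //.
have <- : S 1%N = \sum_x \prod_(u <- us) chi (u.1 - x) ^+ u.2.
  have [unE _ memE] := HE 1%N isT.
  rewrite /S /ext_sum (perm_big [seq phi x | x : F]) /=; last first.
    apply: uniq_perm => //; first by rewrite map_inj_uniq ?enum_uniq //;
      apply: fmorph_inj.
    move=> x; rewrite memE expn1; apply/idP/idP =>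
      [/eqP/(extension_fixed phi)[y <-]|/imageP[y _ ->]]; first exact: image_f.
    by rewrite -rmorphXn expf_card.
  rewrite big_map big_enum; apply: eq_bigr => x _.
  rewrite /ext_exponent big_ord1 expn0 muln1 ext_polyE.
  under eq_bigr do rewrite -rmorphB -rmorphXn.
  rewrite -rmorph_prod -rmorphXn root_char_map -[root_char _ _ _ _]/(chi _).
  rewrite (residue_char_prod cardF prim_eps prim_w); apply: eq_bigr => u _.
  exact: (residue_charX cardF prim_eps prim_w).
rewrite SE // normrN /p (le_trans (ler_norm_sum _ _ _)) //.
apply: (@le_trans _ _ (\sum_(z <- ws) sqrtC q%:R)).
  by rewrite big_seq [leRHS]big_seq ler_sum // => z /ws_bound; rewrite expr1.
rewrite big_const_seq count_predT iter_addr_0 -[_ *+ size ws]mulr_natl ler_wpM2r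
  ?sqrtC_ge0 // ler_nat.
by rewrite -ltnS szws prednK // size_poly.
Qed.

End WeilBound.

(** * Elements in prescribed cosets of the d-th powers *)

(** Dividing d and all the exponents by their common divisor b, and replacing chi
    by its b-th power, reduces to exponents without common divisor. *)
Theorem weil_bound (F : finFieldType) (d e : nat) (eps : F) (w : algC) (us :
  seq (F * nat)) :
    #|F| = (d * e + 1)%N -> d.-primitive_root eps -> d.-primitive_root w ->
    uniq [seq u.1 | u <- us] -> (exists2 u, u \in us & ~~ (d %| u.2)%N) ->
  `|\sum_x \prod_(u <- us) residue_char d e eps w (u.1 - x) ^+ u.2|
     <= (size us).-1%:R * sqrtC #|F|%:R.
Proof.
move=> cardF prim_eps prim_w un [u0 u0us du0].
have d0 := prim_order_gt0 prim_eps.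
pose G := \big[gcdn/0%N]_(u <- us) u.2; pose b := gcdn d G.
have b0 : (0 < b)%N by rewrite gcdn_gt0 d0.
have bd : (b %| d)%N by apply: dvdn_gcdl.
have bu u : u \in us -> (b %| u.2)%N.
  move=> uus; apply: dvdn_trans (dvdn_gcdr d G) _.
  by rewrite /G (big_rem _ uus) /= dvdn_gcdl.
have dE : (d = d %/ b * b)%N by rewrite divnK.
have prim_eps' : (d %/ b).-primitive_root (eps ^+ b).
  by have := exp_prim_root prim_eps b; rewrite (gcdn_idPl bd).
have prim_w' : (d %/ b).-primitive_root (w ^+ b).
  by have := exp_prim_root prim_w b; rewrite (gcdn_idPl bd).
have cardF' : #|F| = (d %/ b * (b * e) + 1)%N by rewrite mulnA -dE.
have charE z : residue_char (d %/ b) (b * e) (eps ^+ b) (w ^+ b) z =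
  residue_char d e eps w z ^+ b.
  rewrite /residue_char mulnC exprM.
  have /orP[/eqP->|/eqP/(prim_rootP prim_eps)[j ->]] := residue_unity cardF z.
    by rewrite expr0n gtn_eqF //= !root_char0 // expr0n gtn_eqF.
  by rewrite exprAC !root_charX // exprAC.
pose us' := [seq (u.1, u.2 %/ b)%N | u <- us].
have -> : \sum_x \prod_(u <- us) residue_char d e eps w (u.1 - x) ^+ u.2
    = \sum_x \prod_(u <- us') residue_char (d %/ b) (b * e) (eps ^+ b) (w ^+ b) (u.1 -
      x) ^+ u.2.
  apply: eq_bigr => x _; rewrite big_map big_seq [RHS]big_seq; apply: eq_bigr =>
    u /bu bu'.
  by rewrite /= charE -exprM mulnC divnK.
rewrite -[size us](size_map (fun u => (u.1, u.2 %/ b)%N)) -/us'.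
apply: weil_bound_primitive => //.
- by rewrite -map_comp.
- rewrite ltn_neqAle divn_gt0 // dvdn_leq // andbT eq_sym; apply/eqP => db1.
  by case/negP: du0; rewrite dE db1 mul1n bu.
move=> s H; have dG : (d %| s * G)%N.
  have dsu u : u \in us -> (d %| s * u.2)%N.
    move=> uus; have := H _ (map_f (fun u => (u.1, u.2 %/ b)%N) uus).
    by rewrite /= -(dvdn_pmul2r b0) -dE -mulnA divnK ?bu.
  rewrite /G; have : {subset us <= us} by []; elim: {-2}us => [|u vs IH] sub.
    by rewrite big_nil muln0.
  rewrite big_cons muln_gcdr dvdn_gcd dsu ?sub ?mem_head //= IH // => v vvs.
  by rewrite sub // inE vvs orbT.
by rewrite -(dvdn_pmul2r b0) -dE /b muln_gcdr dvdn_gcd dvdn_mull.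
Qed.

Section Selection.
Variables (F : finFieldType) (d e : nat) (eps : F).
Hypotheses (cardF : #|F| = (d * e + 1)%N) (prim_eps : d.-primitive_root eps).
Local Notation q := #|F|.

(** The quantity U of the threshold as a natural number: (d - 1)^h C(m, h) choices
    of characters are nontrivial at exactly h of the m points, and each of them
    costs (h - 1) sqrt q. *)
Definition weil_weight (d m : nat) : nat := (\sum_(1 <= h < m.+1) 'C(m, h) * (d - 1) ^
  h * (h - 1))%N.

Lemma sum_support_pred m : (0 < d)%N ->
  (\sum_(a : {ffun 'I_m -> 'I_d}) (#|[set i | a i != 0 :> nat]|).-1 =
    weil_weight d m)%N.
Proof.
move=> d0; pose z := Ordinal d0.
pose supp (a : {ffun 'I_m -> 'I_d}) := [set i | a i != 0 :> nat].
rewrite (partition_big supp xpredT) //.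
transitivity (\sum_(A : {set 'I_m}) (d - 1) ^ #|A| * #|A|.-1)%N.
  apply: eq_bigr => A _.
  rewrite (eq_bigr (fun=> #|A|.-1)); last by move=> a /eqP <-.
  rewrite sum_nat_const; congr (_ * _)%N.
  have := card_pffun_on z A (predC1 z); rewrite cardC1 card_ord subn1 => <-.
  apply: eq_card => a; rewrite -[LHS]/(supp a == A); apply/eqP/pffun_onP =>
    [<-|[sub img]].
    split; first by apply/subsetP => i; rewrite !inE.
    by move=> c /imageP[i]; rewrite !inE => ai ->.
  apply/setP => i; rewrite inE; apply/idP/idP => [ai|iA].
    by apply: (subsetP sub).
  by have := img (a i); rewrite !inE; apply; apply: image_f.
rewrite (partition_big (fun A : {set 'I_m} => inord #|A| : 'I_m.+1) xpredT) //=.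
have cardm (A : {set 'I_m}) : (#|A| < m.+1)%N by rewrite ltnS -[m in leqRHS]card_ord
  max_card.
rewrite /weil_weight.
transitivity (\sum_(h < m.+1) 'C(m, h) * (d - 1) ^ h * (h - 1))%N.
  apply: eq_bigr => h _.
  rewrite (eq_bigr (fun=> (d - 1) ^ h * (h - 1)))%N; last first.
    by move=> A /eqP <-; rewrite inordK // !subn1.
  rewrite sum_nat_const -mulnA; congr (_ * _)%N.
  have <- : #|[set A : {set 'I_m} | #|A| == h]| =
    'C(m, h) by rewrite card_draws card_ord.
  apply: eq_card => A.
  rewrite inE -[LHS]/((inord #|A| : 'I_m.+1) == h) -val_eqE /= inordK //.
by rewrite big_ord_recl /= muln0 add0n big_add1 big_mkord.
Qed.

Variable w : algC.
Hypothesis prim_w : d.-primitive_root w.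
Local Notation chi := (residue_char d e eps w).
Let d_gt0 : (0 < d)%N := prim_order_gt0 prim_eps.

Lemma norm_residue_char z : `|chi z| <= 1.
Proof.
rewrite /residue_char.
have /orP[/eqP->|/eqP/(prim_rootP prim_eps)[j ->]] := residue_unity cardF z.
  by rewrite root_char0 // normr0 ler01.
by rewrite root_charX // normrX (normr_prim_root prim_w) expr1n.
Qed.

Section Detector.
Variables (m : nat) (cs : 'I_m -> F) (b : 'I_m -> nat).
Hypothesis cs_inj : injective cs.
Let c := (m * d ^ m.-1)%N.
Let U := weil_weight d m.

(** Equal to d or 0 according as cs i - x has the prescribed e-th power or not,
    except at x = cs i, where it is 1. *)
Definition class_detector (i : 'I_m) (x : F) : algC :=
  \sum_(j < d) (chi (cs i - x) / w ^+ b i) ^+ j.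

Lemma class_detector_eq0 i x : cs i != x -> (cs i - x) ^+ e != eps ^+ b i ->
  class_detector i x = 0.
Proof.
move=> neq ncl; have z0 : cs i - x != 0 by rewrite subr_eq0.
have w0 := prim_root_neq0 prim_w.
have ze0 : (cs i - x) ^+ e != 0 by rewrite expf_neq0.
have := residue_unity cardF (cs i - x); rewrite (negPf ze0) /= =>
  /eqP/(prim_rootP prim_eps)[j jE].
have chiE : chi (cs i - x) = w ^+ j by rewrite /residue_char jE root_charX.
rewrite /class_detector chiE; set t := _ / _.
have t1 : t != 1.
  apply: contra ncl => /eqP t1; rewrite jE (eq_prim_root_expr prim_eps)
    -(eq_prim_root_expr prim_w).
  by rewrite -[w ^+ b i]mul1r -t1 divfK ?expf_neq0.
have : (t - 1) * \sum_(j0 < d) t ^+ j0 = 0.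
  rewrite -subrX1 /t expr_div_n !(exprAC _ _ d) (prim_expr_order prim_w) !expr1n divr1
    subrr //.
by move/eqP; rewrite mulf_eq0 subr_eq0 (negPf t1) => /eqP.
Qed.

Lemma norm_class_detector i x : `|class_detector i x| <= d%:R.
Proof.
rewrite (le_trans (ler_norm_sum _ _ _)) // -[d in leRHS]card_ord -sumr_const ler_sum //
  => j _.
rewrite normrX normrM normfV normrX (normr_prim_root prim_w) expr1n divr1.
by rewrite exprn_ile1 // norm_residue_char.
Qed.

Lemma class_detector_self i : class_detector i (cs i) = 1.
Proof.
rewrite /class_detector subrr residue_char0 // mul0r (bigD1 (Ordinal d_gt0)) //= expr0.
rewrite big1 ?addr0 // => j; rewrite -val_eqE /= => j0; by rewrite expr0n (negPf j0).
Qed.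

(** If no x is suitable, only the m points themselves contribute to the sum. *)
Lemma detector_small :
  (forall x, exists i, (cs i - x) ^+ e != eps ^+ b i) ->
  `|\sum_x \prod_i class_detector i x| <= c%:R.
Proof.
move=> bad; rewrite (le_trans (ler_norm_sum _ _ _)) //.
apply: (@le_trans _ _ (\sum_x \sum_(i < m) (cs i == x)%:R * (d ^ m.-1)%:R)).
  apply: ler_sum => x _.
  case: (pickP (fun i => cs i == x)) => [i /eqP <-|nocs].
    rewrite [leRHS](bigD1 i) //= eqxx mul1r.
    rewrite -[leLHS]addr0 lerD ?sumr_ge0 // => [|j _]; last by rewrite mulr_ge0 ?ler0n.
    rewrite (bigD1 i) //= class_detector_self mul1r normr_prod.
    have -> : m.-1 = #|[pred j | j != i]| by have := cardC1 i; rewrite card_ord => <-.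
    rewrite natrX -prodr_const.
    by apply: ler_prod => j _; rewrite normr_ge0 norm_class_detector.
  have [i ncl] := bad x.
  rewrite (bigD1 i) //= (class_detector_eq0 _ ncl) ?nocs // mul0r normr0.
  by rewrite sumr_ge0 // => j _; rewrite mulr_ge0 ?ler0n.
rewrite exchange_big /= (eq_bigr (fun=> (d ^ m.-1)%:R)).
  by rewrite sumr_const card_ord -[_ *+ m]mulr_natl -natrM.
move=> i _; rewrite (bigD1 (cs i)) //= eqxx mul1r big1 ?addr0 // => x.
by rewrite eq_sym => /negPf ->; rewrite mul0r.
Qed.

(** Expanding the product gives one character sum for each choice of exponents;
    the zero exponents give q and the others are bounded by [weil_bound]. *)
Lemma detector_large :
  `|\sum_x \prod_i class_detector i x - q%:R| <= U%:R * sqrtC q%:R.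
Proof.
pose term (a : {ffun 'I_m -> 'I_d}) := \sum_x \prod_i (chi (cs i - x) / w ^+ b i) ^+ a
  i.
have -> : \sum_x \prod_i class_detector i x = \sum_a term a.
  rewrite exchange_big; apply: eq_bigr => x _ /=.
  by rewrite bigA_distr_bigA.
pose z : {ffun 'I_m -> 'I_d} := [ffun=> Ordinal d_gt0].
rewrite (bigD1 z) //= [term z](_ : _ = q%:R); last first.
  rewrite /term (eq_bigr (fun=> 1)) ?sumr_const //.
  by move=> x _; apply: big1 => i _; rewrite ffunE expr0.
rewrite addrAC subrr add0r (le_trans (ler_norm_sum _ _ _)) //.
rewrite /U -(sum_support_pred m d_gt0) natr_sum mulr_suml.
apply: (@le_trans _ _ (\sum_(a | a != z) (#|[set i | a i != 0 :> nat]|).-1%:R * sqrtC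
  q%:R)); last first.
  rewrite [leRHS](bigD1 z) //= lerDr mulr_ge0 ?sqrtC_ge0 ?ler0n //.
apply: ler_sum => a az.
pose us := [seq (cs i, a i : nat) | i <- enum [set i | a i != 0 :> nat]].
have [i0 ai0] : exists i, a i != 0 :> nat.
  apply/existsP; apply: contraNT az => /existsPn H; apply/eqP/ffunP => i.
  by rewrite ffunE; apply: val_inj; apply/eqP; have := H i; rewrite negbK.
have -> : #|[set i | a i != 0 :> nat]| = size us by rewrite size_map cardE.
have termE : term a = (\prod_i w ^+ b i ^- a i) * \sum_x \prod_(u <- us) chi (u.1 - x)
  ^+ u.2.
  rewrite mulr_sumr; apply: eq_bigr => x _.
  rewrite big_map big_enum_cond /= [X in _ * X](_ : _ = \prod_i chi (cs i - x) ^+ a i).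
    by rewrite -big_split; apply: eq_bigr => i _; rewrite expr_div_n mulrC.
  rewrite [RHS](bigID (fun i => a i != 0 :> nat)) /= [X in _ = _ * X]big1 ?mulr1.
    by apply: eq_bigl => i; rewrite inE andbT.
  by move=> i; rewrite negbK => /eqP->.
rewrite termE normrM normr_prod big1 ?mul1r; last first.
  by move=> i _; rewrite normfV !normrX (normr_prim_root prim_w) !expr1n invr1.
apply: weil_bound => //.
  rewrite -map_comp map_inj_uniq ?enum_uniq //.
exists (cs i0, a i0 : nat); first by apply/mapP; exists i0; rewrite // mem_enum inE.
by rewrite /= /dvdn modn_small // (negPf ai0).
Qed.

Lemma detector_selection : (c < q)%N -> (U ^ 2 * q < (q - c) ^ 2)%N ->
  exists x, forall i, (cs i - x) ^+ e = eps ^+ b i.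
Proof.
move=> cq Uq; suff /existsP[x /forallP H] : [exists x, [forall i, (cs i - x) ^+ e ==
  eps ^+ b i]].
  by exists x => i; apply/eqP.
apply: contraLR Uq => /existsPn bad; rewrite -leqNgt.
have small : `|\sum_x \prod_i class_detector i x| <= c%:R.
  by apply: detector_small => x; have /forallPn := bad x.
have ineq : (q - c)%:R <= U%:R * sqrtC q%:R :> algC.
  rewrite natrB ?(ltnW cq) // lerBlDr (le_trans _ (lerD detector_large small)) //.
  rewrite -[q%:R in leLHS]normr_nat distrC.
  by rewrite (le_trans _ (ler_normD _ _)) // subrK.
have := ineq; rewrite -(@ler_pXn2r _ 2) ?nnegrE ?ler0n ?mulr_ge0 ?sqrtC_ge0 ?ler0n //.
by rewrite exprMn sqrtCK -!natrX -natrM ler_nat.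
Qed.

End Detector.

(** A list of fewer than m points is first completed to m points, since the
    threshold is stated for m of them. *)
Theorem class_selection (m : nat) (cs : seq F) (b : F -> nat) :
    let c := (m * d ^ m.-1)%N in
    (c < q)%N -> (weil_weight d m ^ 2 * q < (q - c) ^ 2)%N ->
    uniq cs -> (size cs <= m)%N ->
  exists x, forall c, c \in cs -> (c - x) ^+ e = eps ^+ b c.
Proof.
move=> c cq Uq un szm.
have mq : (m <= q)%N by rewrite (leq_trans _ (ltnW cq)) // leq_pmulr // expn_gt0 d_gt0.
pose ds := take m (cs ++ [seq y <- enum F | y \notin cs]).
have un_all : uniq (cs ++ [seq y <- enum F | y \notin cs]).
  rewrite cat_uniq un filter_uniq ?enum_uniq // andbT.
  by apply/hasPn => y; rewrite mem_filter => /andP[].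
have sz_all : size (cs ++ [seq y <- enum F | y \notin cs]) = q.
  rewrite cardE; apply: perm_size; apply: uniq_perm => //; first exact: enum_uniq.
  by move=> y; rewrite mem_cat mem_filter mem_enum andbT orbN.
have szds : size ds = m by rewrite size_takel // sz_all.
pose f (i : 'I_m) := nth 0 ds i.
have f_inj : injective f.
  move=> i j /eqP; rewrite nth_uniq ?szds ?take_uniq // => /eqP; exact: val_inj.
have [x Hx] := detector_selection (fun i => b (f i)) f_inj cq Uq.
exists x => y ycs; have yds : y \in ds.
  by rewrite /ds take_cat; case: ltnP => h; [rewrite ltnNge szm in h|rewrite mem_cat
    ycs].
have lt : (index y ds < m)%N by rewrite -szds index_mem.
by have := Hx (Ordinal lt); rewrite /f /= nth_index.
Qed.

End Selection.

(** * The threshold, and twin prime power difference sets *)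

(** With s = sqrt q, the hypothesis says that s exceeds the larger root of
    s^2 - U s - c, where c = m d^(m-1); squaring s U < q - c removes the root. *)
Lemma threshold_nat (R : rcfType) (d m q : nat) : (0 < d)%N ->
    Qbound R d m < q%:R ->
  (m * d ^ m.-1 < q)%N /\ (weil_weight d m ^ 2 * q < (q - m * d ^ m.-1) ^ 2)%N.
Proof.
move=> d0; have -> : Qbound R d m = 4^-1 * ((weil_weight d m)%:R +
    Num.sqrt ((weil_weight d m)%:R ^+ 2 + 4 * d%:R ^+ m.-1 * m%:R)) ^+ 2.
  suff UE : Ubound R d m = (weil_weight d m)%:R by rewrite /Qbound UE.
  rewrite /Ubound /weil_weight natr_sum !big_nat; apply: eq_bigr => h /andP[h1 _].
  by rewrite !natrM natrX !natrB.
set U := weil_weight d m; set c := (m * d ^ m.-1)%N.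
have -> : 4 * d%:R ^+ m.-1 * m%:R = 4 * c%:R :> R by rewrite /c natrM natrX; ring.
have c0 : 0 <= c%:R :> R by apply: ler0n.
have U0 : 0 <= U%:R :> R by apply: ler0n.
have q0 : 0 <= q%:R :> R by apply: ler0n.
set t := Num.sqrt _; have t0 : 0 <= t by apply: sqrtr_ge0.
have t2 : t ^+ 2 = U%:R ^+ 2 + 4 * c%:R by rewrite sqr_sqrtr //; nra.
set s := Num.sqrt (q%:R : R); have s0 : 0 <= s by apply: sqrtr_ge0.
have s2 : s ^+ 2 = q%:R by rewrite sqr_sqrtr.
rewrite -s2 => H.
have H1 : U%:R + t < 2 * s.
  rewrite -(@ltr_pXn2r _ 2) ?nnegrE //; [|by nra|by nra].
  by rewrite exprMn; lra.
have H2 : c%:R + s * U%:R < s ^+ 2.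
  have : t ^+ 2 < (2 * s - U%:R) ^+ 2 by rewrite ltr_pXn2r ?nnegrE //; lra.
  rewrite t2; nra.
have cq : (c < q)%N.
  rewrite -(ltr_nat R) -s2; have := mulr_ge0 s0 U0; lra.
split=> //; rewrite -(ltr_nat R) natrM !natrX natrB ?(ltnW cq) // -s2 -exprMn ltr_pXn2r
  ?nnegrE //.
- lra.
- by rewrite mulr_ge0.
- by rewrite subr_ge0 s2 ler_nat ltnW.
Qed.

Section Quadratic.
Variables (F : finFieldType) (n : nat).
Hypothesis cardF : #|F| = (2 * n + 1)%N.
Local Notation chi := (residue_char 2 n (-1 : F) (-1)).

Lemma prim_root_opp1 (A : idomainType) : 2%:R != 0 :> A -> 2.-primitive_root (-1 : A).
Proof.
move=> n0; have m1 : -1 != 1 :> A by rewrite eq_sym -subr_eq0 opprK -mulr2n.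
apply/andP; split=> //; apply/forallP => -[[|[|i]] //= _] /=.
  by rewrite unity_rootE expr1 (negPf m1).
by rewrite unity_rootE sqrrN expr1n !eqxx.
Qed.

Lemma odd_char : 2%:R != 0 :> F.
Proof.
apply/negP => c2; have p2 : 2%N \in [pchar F] by rewrite inE.
have := pchar_card_finField F; rewrite (eq_pnat _ (pcharf_eq p2)) => /p_natP[k cardE].
case: k cardE (finNzRing_gt1 F) => [->|k cardE _] //.
by have := congr1 odd cardE; rewrite cardF addn1 oddX /= mul2n odd_double.
Qed.

Let prim_F := prim_root_opp1 odd_char.
Let prim_C : 2.-primitive_root (-1 : algC).
Proof. by apply: prim_root_opp1; rewrite pnatr_eq0. Qed.

Let chiM : {morph chi : x y / x * y} := residue_charM cardF prim_F prim_C.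
Let chi0 : chi 0 = 0 := residue_char0 _ cardF prim_F.

Lemma quad_char_sqr z : z != 0 -> chi z ^+ 2 = 1.
Proof.
move=> z0; have := residue_unity cardF z; rewrite expf_eq0 (negPf z0) andbF /=.
move/eqP/(prim_rootP prim_F) => [j jE].
by rewrite /residue_char jE root_charX // -exprM mulnC exprM sqrrN !expr1n.
Qed.

Lemma quad_char_opp1 : chi (-1) = (-1) ^+ n.
Proof. by rewrite /residue_char root_charX. Qed.

Lemma sum_quad_char : \sum_z chi z = 0.
Proof.
have := sum_residue_charX cardF prim_F prim_C (a := 1) isT.
by under eq_bigr do rewrite expr1.
Qed.

(** For z <> 0 the term equals chi (1 + a / z), and a / z runs over the nonzero
    elements. *)
Lemma quad_char_corr a : a != 0 -> \sum_z chi z * chi (z + a) = -1.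
Proof.
move=> a0; rewrite (bigD1 0) //= chi0 mul0r add0r.
transitivity (\sum_(z | z != 0) chi (1 + a / z)).
  apply: eq_bigr => z z0.
  have -> : z + a = z * (1 + a / z) by rewrite mulrDr mulr1 [_ * (a / z)]mulrC divfK.
  by rewrite chiM mulrA -expr2 quad_char_sqr // mul1r.
rewrite (reindex (fun t => a / t)) /=; last first.
  by exists (fun t => a / t) => t _; rewrite invf_div mulrC divfK.
rewrite (eq_bigl (fun t => t != 0)); last first.
  by move=> t; rewrite mulf_eq0 invr_eq0 (negPf a0).
rewrite (eq_bigr (fun t => chi (1 + t))); last first.
  by move=> t t0; rewrite invf_div mulrC divfK.
have : \sum_t chi (1 + t) = 0.
  rewrite -[RHS]sum_quad_char [RHS](reindex (fun t => 1 + t)) //.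
  by exists (fun t => t - 1) => t _; rewrite ?[1 + _]addrC ?addrK ?subrK.
rewrite (bigD1 0) //= addr0 (residue_char1 _ prim_F prim_C) addrC => /eqP.
by rewrite addr_eq0 => /eqP.
Qed.

Lemma quad_char_autocorr a :
  \sum_z chi z * chi (z + a) = (if a == 0 then #|F|%:R - 1 else -1).
Proof.
have [->|a0] := eqVneq a 0; last exact: quad_char_corr.
rewrite (bigD1 0) //= chi0 mul0r add0r (eq_bigr (fun=> 1)); last first.
  by move=> z z0; rewrite addr0 -expr2 quad_char_sqr.
have := cardC1 (0 : F); rewrite sumr_const => ->.
by rewrite -subn1 natrB // ltnW // finNzRing_gt1.
Qed.

End Quadratic.

Section TwinDifferenceSet.
Variables (F1 F2 : finFieldType) (n : nat).
Hypotheses (cardF1 : #|F1| = (2 * n + 1)%N) (cardF2 : #|F2| = (2 * n.+1 + 1)%N).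
Local Notation chi1 := (residue_char 2 n (-1 : F1) (-1)).
Local Notation chi2 := (residue_char 2 n.+1 (-1 : F2) (-1)).

Let delta (A : nzRingType) (x : A) : algC := (x == 0)%:R.

(** The sign function of the twin prime power difference set: chi1(x) chi2(y) when
    x and y are nonzero, 1 when y = 0, and -1 when x = 0 and y is not.  Written
    as a sum of four products of functions of x and y so that its
    autocorrelation factors. *)
Definition twin_sign (z : F1 * F2) : algC :=
  chi1 z.1 * chi2 z.2 + delta z.2 - delta z.1 + delta z.1 * delta z.2.

Definition twin_set : {set F1 * F2} := [set z | twin_sign z == -1].

Let corr (A : finFieldType) (f g : A -> algC) (a : A) := \sum_x f x * g (x + a).

Lemma twin_signE z : 1 - twin_sign z = 2 * (z \in twin_set)%:R.
Proof.
rewrite inE; suff /orP[/eqP->|/eqP->] : (twin_sign z == 1) || (twin_sign z == -1).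
- by rewrite subrr -addr_eq0 -(natrD _ 1 1) pnatr_eq0 mulr0.
- by rewrite eqxx mulr1 opprK.
case: z => x y; rewrite /twin_sign /delta /=.
have [->|x0] := eqVneq x 0; have [->|y0] := eqVneq y 0.
- by rewrite (residue_char0 _ cardF1 (prim_root_opp1 (odd_char cardF1))) mul0r add0r
  subrr add0r mulr1 eqxx.
- by rewrite (residue_char0 _ cardF1 (prim_root_opp1 (odd_char cardF1))) mul0r add0r
  mulr0 addr0 sub0r eqxx orbT.
- by rewrite (residue_char0 _ cardF2 (prim_root_opp1 (odd_char cardF2))) mulr0 add0r
  subr0 mul0r addr0 eqxx.
rewrite mulr0 addr0 subr0 addr0 -sqrf_eq1 exprMn.
by rewrite (quad_char_sqr cardF1) // (quad_char_sqr cardF2) // mulr1.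
Qed.

Lemma sum_prod_fun (f : F1 -> algC) (g : F2 -> algC) :
  \sum_(z : F1 * F2) f z.1 * g z.2 = (\sum_x f x) * (\sum_y g y).
Proof. by rewrite big_distrlr /= pair_bigA. Qed.

Lemma sum_delta (A : finFieldType) : \sum_(x : A) delta x = 1.
Proof.
by rewrite (bigD1 0) //= /delta eqxx big1 ?addr0 // => x /negPf ->.
Qed.

Lemma corr_delta_l (A : finFieldType) (f : A -> algC) a : corr (@delta A) f a = f a.
Proof.
rewrite /corr (bigD1 0) //= /delta eqxx mul1r add0r big1 ?addr0 // => x /negPf ->.
by rewrite mul0r.
Qed.

Lemma corr_delta_r (A : finFieldType) (f : A -> algC) a : corr f (@delta A) a = f (- a).
Proof.
rewrite /corr (bigD1 (- a)) //= /delta addNr eqxx mulr1 big1 ?addr0 // => x xa.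
by rewrite addr_eq0 (negPf xa) mulr0.
Qed.

Lemma corr_one_r (A : finFieldType) (f : A -> algC) a : corr f (fun=> 1) a = \sum_x f x.
Proof. by apply: eq_bigr => x _; rewrite mulr1. Qed.

Lemma corr_one_l (A : finFieldType) (f : A -> algC) a : corr (fun=> 1) f a = \sum_x f x.
Proof.
rewrite /corr [RHS](reindex (fun x => x + a)) /=; last first.
  by exists (fun x => x - a) => x _; rewrite ?addrK ?subrK.
by apply: eq_bigr => x _; rewrite mul1r.
Qed.

Lemma sum_twin_sign : \sum_z twin_sign z = -1.
Proof.
rewrite /twin_sign !big_split /= sumrN sum_prod_fun.
rewrite (sum_quad_char cardF1) mul0r add0r.
rewrite (sum_prod_fun (@delta F1) (@delta F2)) !sum_delta.
rewrite (eq_bigr (fun z : F1 * F2 => 1 * delta z.2)) => [|z _]; last by rewrite mul1r.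
rewrite (sum_prod_fun (fun=> 1)) [X in _ - X](eq_bigr (fun z : F1 * F2 =>
  delta z.1 * 1)) => [|z _]; last by rewrite mulr1.
rewrite (sum_prod_fun _ (fun=> 1)) !sum_delta !sumr_const cardF1 cardF2 !natrD !natrM
  -[n.+1]addn1 natrD.
ring.
Qed.

Lemma card_twin_set : (#|twin_set| * 2 = #|F1| * #|F2| + 1)%N.
Proof.
apply/eqP; rewrite -(eqr_nat algC) natrM natrD -card_prod.
have : \sum_z (1 - twin_sign z) = 2 * #|twin_set|%:R.
  rewrite -sum1_card natr_sum mulr_sumr [RHS]big_mkcond /=; apply: eq_bigr => z _.
  by rewrite twin_signE; case: ifP; rewrite ?mulr1 ?mulr0.
by rewrite sumrB sumr_const sum_twin_sign opprK mulrC => ->.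
Qed.

(** The 16 products of correlations cancel down to -1 in each of the three cases.
    The terms chi1(a) chi2(b) and chi1(-a) chi2(-b) cancel because -1 is a square
    in exactly one of the two fields. *)
Lemma twin_autocorr (g : F1 * F2) : g != 0 -> \sum_z twin_sign z * twin_sign (z + g) =
  -1.
Proof.
case: g => a b g0.
pose c k : algC := if k == 2%N then -1 else 1.
pose f k : F1 -> algC := match k with 0%N => chi1 | 1%N => (fun=> 1) | _ =>
  @delta F1 end.
pose h k : F2 -> algC := match k with 0%N => chi2 | 1%N => @delta F2 | 2%N =>
  (fun=> 1) | _ => @delta F2 end.
have sE z : twin_sign z = \sum_(k < 4) c k * (f k z.1 * h k z.2).
  rewrite !big_ord_recl big_ord0 /= /twin_sign /c /= !mul1r mulr1 mulN1r addr0 !addrA.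
  by [].
transitivity (\sum_(k < 4) \sum_(l < 4) c k * c l * (corr (f k) (f l) a * corr (h k) (h
  l) b)).
  under eq_bigr do rewrite !sE mulr_suml.
  rewrite exchange_big; apply: eq_bigr => k _ /=.
  under eq_bigr do rewrite mulr_sumr.
  rewrite exchange_big; apply: eq_bigr => l _ /=.
  rewrite -(sum_prod_fun (fun x => f k x * f l (x + a)) (fun y =>
    h k y * h l (y + b))) mulr_sumr.
  by apply: eq_bigr => z _; ring.
have ca : corr chi1 chi1 a = if a == 0 then #|F1|%:R - 1 else -1 by apply:
  quad_char_autocorr.
have cb : corr chi2 chi2 b = if b == 0 then #|F2|%:R - 1 else -1 by apply:
  quad_char_autocorr.
rewrite !big_ord_recl !big_ord0 /= /c /=.
rewrite ca cb !(corr_one_r, corr_one_l, corr_delta_l, corr_delta_r) !sum_delta.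
rewrite (sum_quad_char cardF1) (sum_quad_char cardF2) !sumr_const.
have opp : chi1 (- a) * chi2 (- b) = - (chi1 a * chi2 b).
  have prim_C : 2.-primitive_root (-1 : algC) by apply: prim_root_opp1;
    rewrite pnatr_eq0.
  rewrite -[- a]mulN1r -[- b]mulN1r (residue_charM cardF1 (prim_root_opp1 (odd_char
    cardF1)) prim_C).
  rewrite (residue_charM cardF2 (prim_root_opp1 (odd_char cardF2)) prim_C).
  rewrite (quad_char_opp1 cardF1) (quad_char_opp1 cardF2) exprS.
  have := sqrr_sign algC n; move: ((-1) ^+ n) => t t2.
  by transitivity (- (chi1 a * chi2 b) * t ^+ 2); [ring | rewrite t2 mulr1].
rewrite opp /delta.
rewrite cardF1 cardF2 !natrD !natrM -[n.+1]addn1 natrD ?oppr_eq0.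
move: g0; rewrite xpair_eqE negb_and; case: (a == 0); case: (b == 0) => //= _; try ring.
Qed.

Lemma twin_difference_count (g : F1 * F2) : g != 0 ->
  (#|[set z in twin_set | (z + g)%R \in twin_set]| * 4 = #|F1| * #|F2| + 1)%N.
Proof.
move=> g0; apply/eqP; rewrite -(eqr_nat algC) natrM natrD -card_prod.
have : \sum_z (1 - twin_sign z) * (1 - twin_sign (z + g))
    = 4 * #|[set z in twin_set | z + g \in twin_set]|%:R.
  rewrite -sum1_card natr_sum mulr_sumr [RHS]big_mkcond /=; apply: eq_bigr => z _.
  rewrite !twin_signE [in RHS]in_set; case: (z \in _); case: (_ \in _) => /=;
    by rewrite ?mulr1n ?mulr0n ?mulr1 ?mulr0 ?mul0r ?mulr0 -?natrM.
rewrite mulrC => <-.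
under eq_bigr do rewrite mulrBr mulr1 mulrBl mul1r.
rewrite !sumrB sumr_const twin_autocorr // sum_twin_sign.
rewrite (_ : \sum_z twin_sign (z + g) = -1); first by apply/eqP; ring.
rewrite -[RHS]sum_twin_sign [RHS](reindex (fun z => z + g)) //.
by exists (fun z => z - g) => z _; rewrite ?addrK ?subrK.
Qed.

End TwinDifferenceSet.

(** * From a signed lift of a difference set to the frame difference family *)

Lemma perm_enum_of_cover (T : finType) (A : {pred T}) (s : seq T) :
  {subset A <= s} -> (size s <= #|A|)%N -> perm_eq s (enum A).
Proof.
move=> sub le; have sub' : {subset enum A <= s} by move=> x; rewrite mem_enum;
  apply: sub.
have le' : (size s <= size (enum A))%N by rewrite -cardE.
have un : uniq s by apply: leq_size_uniq (enum_uniq A) sub' le'.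
have [_ eq_mem] := uniq_min_size (enum_uniq A) sub' le'.
apply: uniq_perm; rewrite ?enum_uniq // => x; by rewrite eq_mem.
Qed.

Lemma size_differences (H : finZmodType) (B : {set H}) :
  (size (differences B) <= #|B| * (#|B| - 1))%N.
Proof.
rewrite /differences size_map size_filter.
have := count_predC (fun xy : H * H => xy.1 == xy.2) (enum (setX B B)).
rewrite -cardE cardsX.
have : (#|B| <= count (fun xy : H * H => xy.1 == xy.2) (enum (setX B B)))%N.
  rewrite -size_filter cardE -(size_map (fun x => (x, x))).
  apply: uniq_leq_size; first by rewrite map_inj_uniq ?enum_uniq // => x y [].
  move=> _ /mapP[x xB ->]; rewrite mem_filter mem_enum in_setX /= eqxx.
  by rewrite mem_enum in xB; rewrite xB.
rewrite mulnBr muln1 (eq_count (a1 := predC _) (a2 := fun xy => xy.1 != xy.2)) //.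
move: (count _ _) (count _ _) => a b; lia.
Qed.

Lemma differencesP (H : finZmodType) (B : {set H}) x y :
  x \in B -> y \in B -> x != y -> x - y \in differences B.
Proof.
move=> xB yB xy; apply/mapP; exists (x, y) => //.
by rewrite mem_filter xy mem_enum in_setX xB yB.
Qed.

Section PairLabels.
Variables (G : finZmodType) (D : {set G}) (l : nat).
Hypothesis oddG : forall g : G, g + g = 0 -> g = 0.
Hypothesis diffD : forall g : G, g != 0 -> #|[set z in D | z + g \in D]| = l.

Let shifts g := [set z in D | z + g \in D].

(** Numbers the pairs (u, v) of D with a given difference.  Of the two opposite
    differences u - v and v - u, the one with the smaller rank is used, so that
    the label of (u, v) is also that of (v, u). *)
Definition pair_label (u v : G) : nat :=
  let g := u - v in
  if (enum_rank g <= enum_rank (- g)%R)%N then index v (enum (shifts g))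
  else index u (enum (shifts (- g))).

Lemma neq_opp (g : G) : g != 0 -> g != - g.
Proof. by apply: contra => /eqP gE; apply/eqP/oddG; rewrite {2}gE subrr. Qed.

Lemma pair_labelC (u v : G) : u != v -> pair_label u v = pair_label v u.
Proof.
move=> uv; have g0 : u - v != 0 by rewrite subr_eq0.
rewrite /pair_label -[v - u]opprB opprK.
have : enum_rank (u - v) != enum_rank (- (u - v)) :> nat.
  by apply: contra (neq_opp g0) => /eqP/val_inj/enum_rank_inj/eqP.
by case: ltngtP.
Qed.

Lemma pair_label_surj (g : G) j : g != 0 -> (j < l)%N ->
  exists u v, [/\ u \in D, v \in D, u - v = g & pair_label u v = j].
Proof.
move=> g0 jl; have ng0 : - g != 0 by rewrite oppr_eq0.
case: (boolP (enum_rank g <= enum_rank (- g)%R)%N) => le.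
  have sz : (j < size (enum (shifts g)))%N by rewrite -cardE diffD.
  have := mem_nth 0 sz; set v := nth _ _ _; rewrite mem_enum inE => /andP[vD vgD].
  exists (v + g), v; split=> //; first by rewrite addrAC subrr add0r.
  rewrite /pair_label; have -> : v + g - v = g by rewrite addrAC subrr add0r.
  by rewrite le index_uniq ?enum_uniq.
have sz : (j < size (enum (shifts (- g))))%N by rewrite -cardE diffD.
have := mem_nth 0 sz; set u := nth _ _ _; rewrite mem_enum inE => /andP[uD ugD].
exists u, (u - g); split=> //; first by rewrite opprB addrCA subrr addr0.
rewrite /pair_label; have -> : u - (u - g) = g by rewrite opprB addrCA subrr addr0.
by rewrite (negPf le) index_uniq ?enum_uniq.
Qed.

End PairLabels.

Section SignedLift.
Variables (G : finZmodType) (F : finFieldType) (l e' : nat) (eps : F).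
Variables (lab : G -> G -> nat) (lab0 : G -> nat).
Local Notation d := (2 * l)%N.
Local Notation e := (2 * e')%N.
Hypothesis two_neq0 : 2%:R != 0 :> F.
Hypothesis prim_eps : d.-primitive_root eps.
Hypothesis e'_gt0 : (0 < e')%N.
Hypothesis sel : forall (cs : seq F) (b : F -> nat), uniq cs ->
  (size cs <= (2 * d).-1)%N ->
  exists x, forall c, c \in cs -> (c - x) ^+ e = eps ^+ b c.

Lemma even_powN (x : F) : (- x) ^+ e = x ^+ e.
Proof. by rewrite !exprM sqrrN. Qed.

Lemma pow_eps_neq0 (x : F) n : x ^+ e = eps ^+ n -> x != 0.
Proof.
move=> xE; apply/eqP => x0; have := prim_root_neq0 prim_eps.
have := congr1 (fun z => z == 0) xE.
by rewrite x0 expr0n gtn_eqF ?muln_gt0 ?e'_gt0 // eqxx => /esym; rewrite expf_eq0 =>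
  /andP[_ ->].
Qed.

Lemma selection_labelled (us : seq (F * nat)) :
  uniq [seq u.1 | u <- us] -> (size us <= (2 * d).-1)%N ->
  exists x, forall u, u \in us -> (u.1 - x) ^+ e = eps ^+ u.2.
Proof.
move=> un sz.
pose b c := (nth (0, 0%N) us (index c [seq u.1 | u <- us])).2.
have [|x Hx] := sel b un; first by rewrite size_map.
exists x => u uus; rewrite Hx ?map_f //; congr (_ ^+ _).
have lt : (index u us < size us)%N by rewrite index_mem.
rewrite /b -[u in index u.1](nth_index (0, 0%N) uus).
rewrite -(nth_map _ 0 (fun u : F * nat => u.1)) // index_uniq ?size_map //.
by rewrite nth_index.
Qed.

(** The value at a new element z must give prescribed e-th powers to x, x - y(v)
    and x + y(v) for the elements v already treated.  As e is even these are the
    e-th powers of c - x for c = 0, y(v), - y(v), and these c are distinct because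
    the y(v) have distinct e-th powers and 2 is invertible. *)
Lemma signed_lift (zs : seq G) :
    uniq zs -> (size zs <= d)%N ->
    (forall z, z \in zs -> lab0 z < d)%N -> {in zs &, injective lab0} ->
    {in zs &, forall u v, u != v -> lab u v = lab v u} ->
  exists y : G -> F,
    (forall z, z \in zs -> y z ^+ e = eps ^+ lab0 z) /\
    {in zs &, forall u v, u != v ->
      (y u - y v) ^+ e = eps ^+ lab u v /\ (y u + y v) ^+ e = eps ^+ (lab u v + l)}.
Proof.
elim: zs => [|z zs IH] /=; first by exists (fun=> 0).
move=> /andP[zNzs un] sz lab0d inj0 labC.
have [|||||y [y0 ypair]] := IH.
- exact: un.
- exact: ltnW.
- by move=> u uzs; apply: lab0d; rewrite inE uzs orbT.
- by move=> u v uzs vzs; apply: inj0; rewrite inE ?uzs ?vzs orbT.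
- by move=> u v uzs vzs; apply: labC; rewrite inE ?uzs ?vzs orbT.
pose us := (0 : F, lab0 z) :: [seq (y v, lab z v) | v <- zs] ++ [seq (- y v, (lab z v +
  l)%N) | v <- zs].
have ynz v : v \in zs -> y v != 0 by move=> vzs; apply: pow_eps_neq0 (y0 v vzs).
have ycl u v : u \in zs -> v \in zs -> y u ^+ e = y v ^+ e -> u = v.
  move=> uzs vzs; rewrite !y0 // => /eqP.
  rewrite (eq_prim_root_expr prim_eps) !modn_small ?lab0d ?inE ?uzs ?vzs ?orbT // =>
    /eqP.
  by apply: inj0; rewrite inE ?uzs ?vzs orbT.
have un_us : uniq [seq u.1 | u <- us].
  rewrite /= map_cat -!map_comp cat_uniq /=.
  apply/and4P; split.
  - rewrite mem_cat; apply/negP => /orP[/mapP[v vzs /= E]|/mapP[v vzs /= E]].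
      by have := ynz v vzs; rewrite -E eqxx.
    by have := ynz v vzs; rewrite -oppr_eq0 -E eqxx.
  - rewrite map_inj_in_uniq // => u v uzs vzs /= E; apply: ycl => //; by rewrite E.
  - apply/hasPn => c /mapP[u uzs /= ->]; apply/negP => /mapP[v vzs /= E].
    have uv : u = v by apply: ycl => //; rewrite -E even_powN.
    have : y v + y v == 0 by rewrite -{1}E uv addNr.
    by rewrite -mulr2n -mulr_natr mulf_eq0 (negPf two_neq0) (negPf (ynz v vzs)).
  rewrite map_inj_in_uniq // => u v uzs vzs /= /oppr_inj E; apply: ycl => //;
    by rewrite E.
have [|x Hx] := selection_labelled un_us.
  by rewrite /= size_cat !size_map; move: sz; lia.
exists (fun u => if u == z then x else y u); split.
  move=> u; rewrite inE; case: eqP => [-> _|_ /= uzs]; last exact: y0.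
  by have := Hx _ (mem_head _ _); rewrite /= sub0r even_powN.
have xpair v : v \in zs -> (x - y v) ^+ e = eps ^+ lab z v /\ (x + y v) ^+ e =
  eps ^+ (lab z v + l).
  move=> vzs; split.
    rewrite -even_powN opprB; apply: (Hx (y v, lab z v)).
    by rewrite inE mem_cat; apply/orP; right; apply/orP; left; apply/mapP; exists v.
  rewrite -even_powN opprD addrC; apply: (Hx (- y v, (lab z v + l)%N)).
  by rewrite inE mem_cat; apply/orP; right; apply/orP; right; apply/mapP; exists v.
move=> u v; rewrite !inE; case: (eqVneq u z) => [->|uz]; case: (eqVneq v z) =>
  [->|vz] //=.
- by move=> _ vzs _; apply: xpair.
- move=> uzs _ _; have [h1 h2] := xpair u uzs.
  rewrite labC ?inE ?uzs ?eqxx ?orbT //.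
  by rewrite -even_powN opprB [y u + x]addrC.
by move=> uzs vzs uv; apply: ypair.
Qed.

End SignedLift.

Section Assembly.
Variables (G : finZmodType) (F : finFieldType) (D : {set G}) (l e' : nat).
Variables (y : G -> F).
Local Notation d := (2 * l)%N.
Local Notation e := (2 * e')%N.
Local Notation k := (2 * d)%N.
Variable eps : F.
Hypothesis cardF : #|F| = (d * e + 1)%N.
Hypothesis prim_eps : d.-primitive_root eps.
Hypothesis two_neq0 : 2%:R != 0 :> F.
Hypothesis cardG : (#|G| = k - 1)%N.
Hypothesis cardD : #|D| = d.
Hypothesis y_cover : forall j, (j < d)%N -> exists2 u, u \in D & y u ^+ e = eps ^+ j.
Hypothesis y_neq0 : forall u, u \in D -> y u != 0.
Hypothesis pair_cover : forall g j, g != 0 -> (j < d)%N ->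
  exists u v, [/\ u \in D, v \in D, u - v = g &
    (y u - y v) ^+ e = eps ^+ j \/ (y u + y v) ^+ e = eps ^+ j].

(** Comparing ranks picks one element from each pair {c, -c}. *)
Definition half_system : {set F} :=
  [set c | (c ^+ e == 1) && (enum_rank c < enum_rank (- c)%R)%N].

Definition block (s : F) : {set G * F} :=
  [set w | (w.1 \in D) && ((w.2 == s * y w.1) || (w.2 == - (s * y w.1)))].

Definition blocks : seq {set G * F} := [seq block s | s <- enum half_system].

Definition zero_fibre : {set G * F} := setX [set: G] [set 0].

Let e_gt0 : (0 < e)%N := residue_exponent_gt0 cardF.

Let half_neq0 s : s \in half_system -> s != 0.
Proof.
rewrite inE => /andP[/eqP s1 _]; apply/eqP => s0.
by move/eqP: s1; rewrite s0 expr0n gtn_eqF // eq_sym oner_eq0.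
Qed.

Lemma neq_oppF (c : F) : c != 0 -> c != - c.
Proof.
move=> c0; rewrite -addr_eq0 -mulr2n -mulr_natr mulf_eq0 negb_or c0.
exact: two_neq0.
Qed.

Lemma card_half_system_le : (#|half_system| * 2 <= e)%N.
Proof.
pose opp (A : {set F}) := [set - c | c in A].
have disj : [disjoint half_system & opp half_system].
  apply/pred0P => c /=; apply/negP => /andP[]; rewrite !inE =>
    /andP[_ lt1] /imsetP[c' ].
  by rewrite inE => /andP[_ lt2] E; move: lt1; rewrite E opprK ltnNge ltnW.
have cardU : #|half_system :|: opp half_system| = (#|half_system| * 2)%N.
  by rewrite cardsU disjoint_setI0 // cards0 subn0 card_imset ?muln2 ?addnn //;
    apply: oppr_inj.
rewrite -cardU cardE; apply: max_unity_roots => //; last exact: enum_uniq.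
apply/allP => c; rewrite mem_enum !inE => /orP[/andP[c1 _]|/imsetP[c']];
  first by rewrite unity_rootE.
by rewrite inE => /andP[c1 _] ->; rewrite unity_rootE even_powN.
Qed.

Lemma half_system_cover (x z : F) : z != 0 -> x ^+ e = z ^+ e ->
  exists2 s, s \in half_system & z = s * x \/ z = - (s * x).
Proof.
move=> z0 xz; have x0 : x != 0.
  apply/eqP => x0; move: xz; rewrite x0 expr0n gtn_eqF // => /esym/eqP.
  by rewrite expf_eq0 (negPf z0) andbF.
pose c := z / x; have c0 : c != 0 by rewrite mulf_neq0 ?invr_eq0.
have c1 : c ^+ e = 1 by rewrite expr_div_n xz mulfV // expf_neq0.
have : enum_rank c != enum_rank (- c) :> nat.
  by apply: contra (neq_oppF c0) => /eqP/val_inj/enum_rank_inj/eqP.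
rewrite neq_ltn => /orP[lt|lt].
  by exists c; [rewrite inE c1 eqxx|left; rewrite /c divfK].
by exists (- c); [rewrite inE even_powN c1 opprK eqxx|right;
  rewrite mulNr opprK /c divfK].
Qed.

Lemma power_class (z : F) : z != 0 -> exists2 j, (j < d)%N & z ^+ e = eps ^+ j.
Proof.
move=> z0; have := residue_unity cardF z; rewrite expf_eq0 (negPf z0) andbF /=.
by move=> /eqP/(prim_rootP prim_eps)[j jE]; exists j.
Qed.

Lemma mem_block s u : u \in D -> (u, s * y u) \in block s /\
  (u, - (s * y u)) \in block s.
Proof. by move=> uD; rewrite !inE uD !eqxx orbT. Qed.

Lemma block_cover (z : F) : z != 0 ->
  exists s u, [/\ s \in half_system, u \in D & (u, z) \in block s].
Proof.
move=> z0; have [j jd zE] := power_class z0; have [u uD yE] := y_cover jd.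
have [|s sS zsE] := @half_system_cover (y u) z z0; first by rewrite yE zE.
exists s, u; split=> //; have [b1 b2] := mem_block s uD.
by case: zsE => ->.
Qed.

Lemma differences_cover (g : G) (z : F) : z != 0 ->
  exists2 s, s \in half_system & (g, z) \in differences (block s).
Proof.
move=> z0; have [->|g0] := eqVneq g 0.
  have z20 : z / 2%:R != 0 by rewrite mulf_neq0 ?invr_eq0.
  have [j jd zE] := power_class z20; have [u uD yE] := y_cover jd.
  have [|s sS zsE] := @half_system_cover (y u) _ z20; first by rewrite yE zE.
  exists s => //; have [b1 b2] := mem_block s uD.
  have zh : z = z / 2%:R + z / 2%:R by rewrite -[LHS](divfK two_neq0) mulr_natr mulr2n.
  have sy0 : s * y u != 0 by exact: mulf_neq0 (half_neq0 sS) (y_neq0 uD).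
  case: zsE => E; rewrite zh E.
    have -> : (0, s * y u + s * y u) = (u, s * y u) - (u, - (s * y u)) :> G * F.
      by congr (_, _); rewrite /= ?subrr ?opprK.
    apply: differencesP => //; apply: contra (neq_oppF sy0) => /eqP[/eqP h]; exact: h.
  have -> : (0, - (s * y u) - (s * y u)) = (u, - (s * y u)) - (u, s * y u) :> G * F.
    by congr (_, _); rewrite /= ?subrr.
  apply: differencesP => //; rewrite eq_sym; apply: contra (neq_oppF sy0) =>
    /eqP[/eqP h]; exact: h.
have [j jd zE] := power_class z0.
have [u [v [uD vD uvE yE]]] := pair_cover g0 jd.
have uv : u != v by rewrite -subr_eq0 uvE.
have uvP (a b : F) : (u, a) != (v, b) by rewrite xpair_eqE (negPf uv).
case: yE => yE.
  have [|s sS zsE] := @half_system_cover (y u - y v) _ z0; first by rewrite yE zE.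
  exists s => //; have [u1 u2] := mem_block s uD; have [v1 v2] := mem_block s vD.
  case: zsE => ->.
    have -> : (g, s * (y u - y v)) = (u, s * y u) - (v, s * y v) :> G * F.
      by congr (_, _); rewrite /= ?uvE ?mulrBr.
    exact: differencesP.
  have -> : (g, - (s * (y u - y v))) = (u, - (s * y u)) - (v, - (s * y v)) :> G * F.
    by congr (_, _); rewrite /= ?uvE ?mulrBr ?opprB ?opprK // addrC.
  exact: differencesP.
have [|s sS zsE] := @half_system_cover (y u + y v) _ z0; first by rewrite yE zE.
exists s => //; have [u1 u2] := mem_block s uD; have [v1 v2] := mem_block s vD.
case: zsE => ->.
  have -> : (g, s * (y u + y v)) = (u, s * y u) - (v, - (s * y v)) :> G * F.
    by congr (_, _); rewrite /= ?uvE ?mulrDr ?opprK.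
  exact: differencesP.
have -> : (g, - (s * (y u + y v))) = (u, - (s * y u)) - (v, s * y v) :> G * F.
  by congr (_, _); rewrite /= ?uvE ?mulrDr ?opprD.
exact: differencesP.
Qed.

Lemma card_block s : s \in half_system -> #|block s| = k.
Proof.
move=> /half_neq0 s0.
pose f (ub : G * bool) : G * F := (ub.1, if ub.2 then s * y ub.1 else - (s * y ub.1)).
have -> : block s = f @: setX D [set: bool].
  apply/setP => -[u z]; apply/idP/imsetP => [|[[u' b]]]; rewrite !inE /=.
    case/andP=> uD /orP[/eqP->|/eqP->].
      by exists (u, true); rewrite // !inE uD.
    by exists (u, false); rewrite // !inE uD.
  by rewrite andbT => u'D [-> ->]; rewrite u'D; case: b; rewrite eqxx ?orbT.
rewrite card_in_imset; first by rewrite cardsX cardD cardsT card_bool mulnC.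
move=> [u b] [u' b']; rewrite !inE /= !andbT => uD u'D [uu'].
subst u'; have sy0 : s * y u != 0 by rewrite mulf_neq0 ?y_neq0.
case: b; case: b' => // /eqP.
  by rewrite (negPf (neq_oppF sy0)).
by rewrite eq_sym (negPf (neq_oppF sy0)).
Qed.

Lemma size_flatten_blocks (T : Type) (f : {set G * F} -> seq T) N :
  (forall s, s \in half_system -> size (f (block s)) <= N)%N ->
  (size (flatten [seq f B | B <- blocks]) <= #|half_system| * N)%N.
Proof.
move=> H; rewrite size_flatten /shape -map_comp sumnE big_map /blocks big_map big_enum
  /=.
rewrite -sum_nat_const; exact: leq_sum.
Qed.

Lemma card_half_system : #|half_system| = e'.
Proof.
apply/eqP; rewrite eqn_leq; apply/andP; split.
  by rewrite -(leq_pmul2r (isT : 0 < 2)%N) (leq_trans card_half_system_le) // mulnC.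
have sub : {subset enum (predC1 (0 : F)) <= flatten [seq [seq w.2 | w <- enum B] | B :
  {set G * F} <- blocks]}.
  move=> z; rewrite mem_enum inE => /block_cover[s [u [sS uD zB]]].
  apply/flatten_mapP; exists (block s); first by apply/map_f; rewrite mem_enum.
  by apply/mapP; exists (u, z); rewrite ?mem_enum.
have k_gt0 : (0 < k)%N by rewrite muln_gt0 (prim_order_gt0 prim_eps).
rewrite -(leq_pmul2r k_gt0).
have <- : (#|F|.-1 = e' * k)%N by rewrite cardF addn1 /= mulnCA mulnC -mulnA [(2 * _)%N
  in RHS]mulnC; lia.
have := uniq_leq_size (enum_uniq _) sub; rewrite -cardE cardC1 => /leq_trans; apply.
by apply: size_flatten_blocks => s sS; rewrite size_map -cardE card_block.
Qed.

Lemma zero_fibreE w : (w \in zero_fibre) = (w.2 == 0).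
Proof. by rewrite !inE. Qed.

Lemma card_zero_fibre : #|zero_fibre| = #|G|.
Proof. by rewrite cardsX cardsT cards1 muln1. Qed.

Lemma add_coset_fibre x : add_coset zero_fibre x = [set w | w.2 == x.2].
Proof.
apply/setP => w; rewrite inE; apply/imsetP/eqP => [[v]|E].
  by rewrite zero_fibreE => /eqP v0 ->; rewrite /= v0 addr0.
exists (w - x); last by rewrite addrC subrK.
by rewrite zero_fibreE /= E subrr.
Qed.

Theorem blocks_FDF : is_elementary_FDF zero_fibre k 1 blocks.
Proof.
have k_gt0 : (0 < k)%N by rewrite muln_gt0 (prim_order_gt0 prim_eps).
have de : (d * e = e' * k)%N by lia.
have sz_blocks : size blocks = e' by rewrite size_map -cardE card_half_system.
split; last by rewrite card_zero_fibre cardG mul1n.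
split.
  split.
  - split; first by rewrite zero_fibreE.
    move=> u v; rewrite !zero_fibreE => /eqP u0 /eqP v0.
    by rewrite /= u0 v0 subrr.
  - by move=> _ /mapP[s sS ->]; apply: card_block; rewrite mem_enum in sS.
  rewrite /= cats0; apply: perm_enum_of_cover.
    move=> [g z]; rewrite inE zero_fibreE /= => z0.
    have [s sS gz] := differences_cover g z0.
    by apply/flatten_mapP; exists (block s) => //; apply: map_f; rewrite mem_enum.
  apply: (leq_trans (size_flatten_blocks (N := k * (k - 1)) _)).
    by move=> s sS; rewrite -[k in leqRHS](card_block sS); apply: size_differences.
  rewrite card_half_system cardsCs setCK card_zero_fibre card_prod cardG cardF de.
  rewrite mulnDr muln1 addnK; apply: eq_leq; rewrite mulnA; exact: mulnC.
exists [:: blocks]; split; first by rewrite /= cats0.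
  by rewrite card_zero_fibre cardG.
move=> S; rewrite inE => /eqP ->; split.
  rewrite sz_blocks card_zero_fibre card_prod cardG cardF de.
  by rewrite mulnDr muln1 addnK; exact: mulnCA.
apply: perm_enum_of_cover.
  move=> C; rewrite !inE => /andP[CN /imsetP[x _ CE]].
  have x0 : x.2 != 0.
    apply: contra CN => /eqP x0; apply/eqP/setP => w.
    by rewrite CE add_coset_fibre inE zero_fibreE x0.
  have [s [u [sS uD xB]]] := block_cover x0.
  rewrite CE; have -> : add_coset zero_fibre x = add_coset zero_fibre (u, x.2).
    by rewrite !add_coset_fibre.
  apply: map_f; apply/flatten_mapP; exists (block s); last by rewrite mem_enum.
  by apply: map_f; rewrite mem_enum.
rewrite size_map; apply: (leq_trans (size_flatten_blocks (N := k) _)).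
  by move=> s sS; rewrite -cardE card_block.
rewrite card_half_system -de.
have -> : (d * e = #|[set~ (0%R : F)]|)%N by rewrite cardsC1 cardF addn1.
rewrite -(card_in_imset (f := fun z => add_coset zero_fibre (0, z))); last first.
  move=> z z' _ _ /setP/(_ (0, z)); rewrite !add_coset_fibre !inE /= eqxx.
  by move/esym/eqP.
apply/subset_leq_card/subsetP => _ /imsetP[z z0 ->].
rewrite !inE imset_f // andbT; apply/eqP => /setP/(_ (0, z)).
by rewrite add_coset_fibre zero_fibreE inE eqxx /= => /esym; apply/negP;
  rewrite !inE in z0.
Qed.

End Assembly.

(** * The existence theorem *)

(** Both would be powers of 2, and 2 and 4 are the only ones at distance 2. *)
Lemma twin_prime_powers_odd p : prime_power p -> prime_power (p + 2) -> (2 < p)%N ->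
  odd p.
Proof.
move=> [r [a [pr_r a0 pE]]] [s [b [pr_s b0 p2E]]] p2; apply/negPn/negP => evp.
have two x c n : prime x -> (0 < c)%N -> n = (x ^ c)%N -> ~~ odd n -> n = (2 ^ c)%N.
  move=> prx c0 nE; rewrite nE oddX negb_or -lt0n c0 /= => evx.
  by case: (even_prime prx) evx => [->|->].
have pE' := two _ _ _ pr_r a0 pE evp.
have p2E' : (p + 2 = 2 ^ b)%N by apply: (two _ _ _ pr_s b0 p2E); rewrite oddD addbF.
case: a pE' {pE a0} p2 evp => [|[|a]] -> // _ _ in p2E'; last first.
  case: b p2E' {p2E b0} => [|[|b]]; rewrite ?expnS; lia.
Qed.

Lemma no_two_torsion_prod (F1 F2 : finFieldType) : 2%:R != 0 :> F1 -> 2%:R != 0 :> F2 ->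
  forall g : F1 * F2, g + g = 0 -> g = 0.
Proof.
have tors (A : finFieldType) (x : A) : 2%:R != 0 :> A -> x + x = 0 -> x = 0.
  move=> h2 /eqP; rewrite -mulr2n -mulr_natr mulf_eq0 (negPf h2) orbF => /eqP //.
by move=> h1 h2 [x z] [/tors -> // /tors -> //].
Qed.

Theorem theorem4p6 (R : rcfType) (p q : nat) (Fp Fp2 Fq : finFieldType)
    (hp : prime_power p) (hp2 : prime_power (p + 2)) (p_gt2 : (2 < p)%N)
    (hq : prime_power q)
    (cardFp : #|Fp| = p) (cardFp2 : #|Fp2| = (p + 2)%N) (cardFq : #|Fq| = q)
    (q_mod : q = 1 %[mod p * (p + 2) + 1])
    (q_gtQ : Qbound R ((p * (p + 2) + 1) %/ 2) (p * (p + 2)) < q%:R) :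
  exists BB : seq {set Fp * Fp2 * Fq},
    is_elementary_FDF (setX [set: Fp * Fp2] [set 0 : Fq])
      (p * (p + 2) + 1) 1 BB.
Proof.
have odd_p := twin_prime_powers_odd hp hp2 p_gt2.
have [n pE] : exists n, p = (2 * n + 1)%N.
  by exists p./2; rewrite -[LHS]odd_double_half odd_p mul2n addnC.
pose l := (n.+1 ^ 2)%N; pose d := (2 * l)%N.
have kE : (p * (p + 2) + 1 = 2 * d)%N by rewrite pE /d /l; lia.
have mE : (p * (p + 2) = (2 * d).-1)%N by rewrite -kE addn1.
have l_gt0 : (0 < l)%N by rewrite expn_gt0.
have d_gt0 : (0 < d)%N by rewrite muln_gt0.
have q_gt1 : (1 < q)%N by rewrite -cardFq finNzRing_gt1.
have [e' qE] : exists e', q = (d * (2 * e') + 1)%N.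
  have /dvdnP[e' E] : (2 * d %| q - 1)%N by rewrite -kE -eqn_mod_dvd ?(ltnW q_gt1) //;
    apply/eqP.
  by exists e'; lia.
have cardF : #|Fq| = (d * (2 * e') + 1)%N by rewrite cardFq.
have e'_gt0 : (0 < e')%N by move: q_gt1; rewrite qE; case: (e'); rewrite ?muln0.
have cardF1 : #|Fp| = (2 * n + 1)%N by rewrite cardFp.
have cardF2 : #|Fp2| = (2 * n.+1 + 1)%N by rewrite cardFp2 pE; lia.
have two_q : 2%:R != 0 :> Fq by apply: (@odd_char _ (d * e')); rewrite cardF; lia.
have [eps prim_eps] := finField_prim_root d_gt0 cardF.
have [w prim_w] := C_prim_root_exists d_gt0.
move: q_gtQ; rewrite kE mulKn // mE => /(threshold_nat d_gt0); rewrite -cardFq =>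
  -[small large].
have sel (cs : seq Fq) (b : Fq -> nat) : uniq cs -> (size cs <= (2 * d).-1)%N ->
    exists x, forall c, c \in cs -> (c - x) ^+ (2 * e') = eps ^+ b c.
  exact: (class_selection cardF prim_eps prim_w).
pose G : finZmodType := (Fp * Fp2)%type.
pose D : {set G} := twin_set Fp Fp2 n.
have cardG : #|G| = (2 * d - 1)%N by rewrite card_prod cardFp cardFp2 mE subn1.
have v1 : (#|Fp| * #|Fp2| + 1 = 2 * d)%N by rewrite cardFp cardFp2.
have cardD : #|D| = d by have := card_twin_set cardF1 cardF2; rewrite v1 mulnC =>
  /eqP; rewrite eqn_pmul2l // => /eqP.
have diffD (g : G) : g != 0 -> #|[set z in D | z + g \in D]| = l.
  move=> g0; have := twin_difference_count cardF1 cardF2 g0;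
    rewrite v1 /d mulnA mulnC => /eqP.
  by rewrite eqn_pmul2l // => /eqP.
have oddG : forall g : G, g + g = 0 -> g = 0.
  exact: no_two_torsion_prod (odd_char cardF1) (odd_char cardF2).
pose lab0 (z : G) := index z (enum D).
have [||||y [y0 ypair]] := signed_lift (lab := pair_label D) (lab0 :=
  lab0) two_q prim_eps e'_gt0 sel (enum_uniq D).
- by rewrite -cardE cardD.
- by move=> z; rewrite -index_mem -cardE cardD.
- move=> u v uD vD E; rewrite -[RHS](nth_index 0 vD) -[LHS](nth_index 0 uD);
  congr nth; exact: E.
- by move=> u v _ _; apply: pair_labelC oddG u v.
exists (blocks D e' y).
apply: (@blocks_FDF G Fq D l e' y eps) => //.
- move=> j jd; have jD : (j < size (enum D))%N by rewrite -cardE cardD.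
  exists (nth 0 (enum D) j); first by rewrite -mem_enum mem_nth.
  by rewrite y0 ?mem_nth // /lab0 index_uniq ?enum_uniq.
- move=> u uD; apply: (pow_eps_neq0 prim_eps e'_gt0 (n := lab0 u)).
  by apply: y0; rewrite mem_enum.
move=> g j g0 jd.
(* Labels below l are used for the y u - y v, and shifted by l for the sums. *)
have [jl|lj] := ltnP j l.
  have [u [v [uD vD uv lab]]] := pair_label_surj diffD g0 jl.
  exists u, v; split=> //; left.
  have [||//|-> _] := ypair u v; rewrite ?mem_enum ?lab //.
  by rewrite -subr_eq0 uv.
have [|u [v [uD vD uv lab]]] := pair_label_surj diffD g0 (j := j - l).
  by rewrite ltn_subLR // addnn -mul2n.
exists u, v; split=> //; right.
have [||//|_ ->] := ypair u v; rewrite ?mem_enum ?lab ?subnK //.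
by rewrite -subr_eq0 uv.
Qed.
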